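(* Let $0<\alpha\le\infty$ and let $f$ be a real function on $(-\alpha,\alpha)$. The following statements hold: (i) $f$ is S-positive if and only if it is analytic on $(-\alpha,\alpha)$ and $f^{(k)}(0)\ge0$ for all $k\ge0$. (ii) $f$ is S-monotone if and only if it is analytic on $(-\alpha,\alpha)$ and $f^{(k)}(0)\ge0$ for all $k\ge1$. (iii) $f$ is S-convex if and only if it is analytic on $(-\alpha,\alpha)$ and $f^{(k)}(0)\ge0$ for all $k\ge2$.
   Context: ''Analytic'' means real analytic. For a real $n\times n$ matrix $A=[a_{ij}]$ with all entries in $(-\alpha,\alpha)$, $f[A]:=[f(a_{ij})]$ is the matrix obtained by applying $f$ entrywise. For real symmetric matrices, $A\ge0$ means $A$ is (symmetric and) positive semidefinite, and $A\ge B$ means $A-B\ge0$. For $n\ge1$: - $f$ is S-positive of order $n$ if $f[A]\ge0$ for all $A\ge0$ in $M_n(\mathbb{R})$ with entries in $(-\alpha,\alpha)$. - $f$ is S-monotone of order $n$ if $A\ge B\ge0$ implies $f[A]\ge f[B]$ for all symmetric $A,B\in M_n(\mathbb{R})$ with entries in $(-\alpha,\alpha)$. - $f$ is S-convex of order $n$ if $A\ge B\ge0$ implies $f[\lambda A+(1-\lambda)B]\le\lambda f[A]+(1-\lambda)f[B]$ for all $0\le\lambda\le1$, for all symmetric $A,B\in M_n(\mathbb{R})$ with entries in $(-\alpha,\alpha)$. The function $f$ is S-positive (resp. S-monotone, S-convex) if it is S-positive (resp. S-monotone, S-convex) of order $n$ for every $n\ge1$. *)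

(* Defs.v *)
From HB Require Import structures.
From mathcomp Require Import all_boot all_order all_algebra.
From mathcomp Require Import all_classical all_reals all_analysis.
Import Order.TTheory GRing.Theory Num.Theory.
Import numFieldNormedType.Exports.

Set Implicit Arguments.
Unset Strict Implicit.
Unset Printing Implicit Defensive.

Local Open Scope classical_set_scope.
Local Open Scope ring_scope.

(* A function on (-alpha, alpha) is represented by a total f : R -> R; every
   notion below only involves its values on sym_itv alpha. *)

Definition sym_itv (R : realType) (alpha : \bar R) : set R :=
  [set x | (- alpha < x%:E < alpha)%E].

Definition real_analytic_on (R : realType) (D : set R) (f : R -> R) : Prop :=
  forall x0, D x0 -> exists a : R^nat,
    \forall x \near x0, pseries a (x - x0) @ \oo --> f x.

Definition symmetric_mx (R : realType) (n : nat) (A : 'M[R]_n) : Prop :=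
  A^T = A.

Definition psd (R : realType) (n : nat) (A : 'M[R]_n) : Prop :=
  symmetric_mx A /\ forall v : 'cV[R]_n, 0 <= (v^T *m A *m v) 0 0.

Definition loewner_le (R : realType) (n : nat) (A B : 'M[R]_n) : Prop :=
  psd (B - A).

Definition entries_in (R : realType) (alpha : \bar R) (n : nat)
    (A : 'M[R]_n) : Prop :=
  forall i j, sym_itv alpha (A i j).

Definition S_positive_of_order (R : realType) (alpha : \bar R) (n : nat)
    (f : R -> R) : Prop :=
  forall A : 'M[R]_n, entries_in alpha A -> psd A -> psd (map_mx f A).

Definition S_monotone_of_order (R : realType) (alpha : \bar R) (n : nat)
    (f : R -> R) : Prop :=
  forall A B : 'M[R]_n, symmetric_mx A -> symmetric_mx B ->
    entries_in alpha A -> entries_in alpha B ->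
    loewner_le B A -> psd B ->
    loewner_le (map_mx f B) (map_mx f A).

Definition S_convex_of_order (R : realType) (alpha : \bar R) (n : nat)
    (f : R -> R) : Prop :=
  forall A B : 'M[R]_n, symmetric_mx A -> symmetric_mx B ->
    entries_in alpha A -> entries_in alpha B ->
    loewner_le B A -> psd B ->
    forall l : R, 0 <= l <= 1 ->
      loewner_le (map_mx f (l *: A + (1 - l) *: B))
                 (l *: map_mx f A + (1 - l) *: map_mx f B).

Definition S_positive (R : realType) (alpha : \bar R) (f : R -> R) : Prop :=
  forall n, (1 <= n)%N -> S_positive_of_order alpha n f.

Definition S_monotone (R : realType) (alpha : \bar R) (f : R -> R) : Prop :=
  forall n, (1 <= n)%N -> S_monotone_of_order alpha n f.

Definition S_convex (R : realType) (alpha : \bar R) (f : R -> R) : Prop :=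
  forall n, (1 <= n)%N -> S_convex_of_order alpha n f.

(* Main.v *)
Require Import Defs.
From HB Require Import structures.
From mathcomp Require Import all_boot all_order all_algebra.
From mathcomp Require Import ring lra zify.
From mathcomp Require Import all_classical all_reals all_analysis.
Import Order.TTheory GRing.Theory Num.Theory.
Import numFieldNormedType.Exports.
Local Open Scope classical_set_scope.
Local Open Scope ring_scope.

(** All three equivalences go through one intermediate property: on the whole
    interval, f is the sum of a power series a_0 + a_1 x + a_2 x^2 + ... whose
    coefficients are nonnegative from the index 0, 1 or 2 on.

    This property is the same as real analyticity together with the sign
    conditions at 0 ([analytic_derive1n_ge0P]).  One direction is recentering
    of power series.  The other is Pringsheim's principle: if the radius on
    which f is the sum of its series at 0 ended inside the interval, the
    expansion of f around the endpoint would force the series, whose terms are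
    nonnegative, to converge a little further ([power_series_pringsheim]).

    A power series of this kind acts on matrices as required because entrywise
    powers do: by Schur's product theorem ([psd_hadamard]) they preserve
    positive semidefiniteness, and the monotone and convex versions follow by
    induction on the exponent.  A constant term is harmless for monotonicity,
    an affine one for convexity.

    For the converse, no regularity of f is given, and finite differences take
    the place of derivatives.  The block matrix with entries A + c, A, A, A is
    positive semidefinite when A is, and testing f of it on vectors (u, -u)
    shows that y |-> f (y + c) - f y is again S-positive ([S_positive_fdiff]).
    Iterating, all forward differences of f are nonnegative on [0, alpha), so
    by Bernstein's theorem f is there a power series with nonnegative
    coefficients ([absolutely_monotone_power_series]); the proof passes to the
    limit in Newton's interpolation formula on dyadic grids.  The same applies
    to x |-> f x + f (- x) and x |-> f x - f (- x), so f is also a power series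
    on (-alpha, 0].  To see that the two series agree, let F be the first one.
    Then f - F vanishes on [0, alpha), so its n-th difference at - t with step t
    is (f - F) (- t) up to sign.  S-positivity of the n-th difference bounds it
    at - t by its value at t, which is O(t^n).  Hence f - F is flat at 0 on the
    left, and it is zero ([S_positive_power_series]).

    If f is S-monotone, comparing A with 0 makes f - f 0 S-positive.  If f is
    S-convex, comparing A with 0 at the midpoint makes
    P x = f x - 2 f (x / 2) + f 0 S-positive, hence a power series.  Dividing
    its coefficient of index k by 1 - 2^(1 - k) for k >= 2 gives a series Q with
    Q x - 2 Q (x / 2) = P x, and what remains of f is linear by convexity
    ([S_convex_power_series]). *)

Set Implicit Arguments.
Unset Strict Implicit.
Unset Printing Implicit Defensive.

(** * Symmetric intervals *)

Section SymItv.
Context {R : realType}.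
Implicit Types (alpha : \bar R) (x y r : R).

Lemma sym_itvE alpha x : sym_itv alpha x <-> (`|x|%:E < alpha)%E.
Proof.
rewrite /sym_itv /=; case: alpha => [r| |] /=.
- by rewrite !lte_fin ltr_norml.
- by rewrite !ltry ltNyr.
- by rewrite !ltNge !leNye.
Qed.

Lemma sym_itv_le alpha x y : `|y| <= `|x| -> sym_itv alpha x -> sym_itv alpha y.
Proof. by move=> xy /sym_itvE xa; apply/sym_itvE; apply: le_lt_trans xa. Qed.

Lemma sym_itv_room alpha x : sym_itv alpha x ->
  exists2 r : R, `|x| < r & sym_itv alpha r.
Proof.
move/sym_itvE => xa; case: alpha xa => [s| |] // xa.
  rewrite lte_fin in xa; exists ((`|x| + s) / 2); first by lra.
  by apply/sym_itvE; rewrite lte_fin ger0_norm; have := normr_ge0 x; lra.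
exists (`|x| + 1); first by rewrite ltrDl.
by apply/sym_itvE; rewrite ltry.
Qed.

Lemma sym_itv_fin x r : sym_itv r%:E x <-> `|x| < r.
Proof. by rewrite sym_itvE lte_fin. Qed.

End SymItv.

(** * Power series near 0 *)

Section PowerSeries.
Context {R : realType}.
Implicit Types (alpha : \bar R) (a b : R^nat) (x y h c r : R).

Definition power_series_on alpha a (f : R -> R) :=
  forall x, sym_itv alpha x -> pseries a x @ \oo --> f x.

Lemma is_cvg_pseries_norm alpha a (f : R -> R) x : power_series_on alpha a f ->
  sym_itv alpha x -> cvgn (pseries (fun k => `|a k|) `|x|).
Proof.
move=> af xa; have [r xr ra] := sym_itv_room xa.
apply: (@is_cvg_pseries_inside_norm _ a r).
  by apply/cvg_ex; exists (f r); exact: af.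
by rewrite normr_id (lt_le_trans xr) ?ler_norm.
Qed.

Lemma pseriesEord a x n : pseries a x n = \sum_(k < n) a k * x ^+ k.
Proof. by rewrite /pseries seriesEord. Qed.

Lemma pseries_le_lim a r n : (forall k, 0 <= a k) -> 0 <= r ->
  cvgn (pseries a r) -> pseries a r n <= limn (pseries a r).
Proof.
move=> a0 r0 cv; apply: nondecreasing_cvgn_le => //.
by apply/nondecreasing_seqP => k; rewrite !pseriesEord big_ord_recr lerDl /=
  mulr_ge0 ?exprn_ge0.
Qed.

(** For k >= n and |x| <= r one has |x|^k <= (|x| / r)^n r^k, so the tail is
    at most (|x| / r)^n times the sum of the |a_k| r^k. *)
Lemma pseries_remainder a r n : 0 < r -> cvgn (pseries (fun k => `|a k|) r) ->
  exists2 C : R, 0 <= C & forall x (l : R), `|x| <= r -> pseries a x @ \oo --> l ->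
    `|l - \sum_(k < n) a k * x ^+ k| <= C * `|x| ^+ n.
Proof.
move=> r0 ar; set M := limn (pseries (fun k => `|a k|) r).
have M0 : 0 <= M.
  have := @pseries_le_lim (fun k => `|a k|) r 0 (fun k => normr_ge0 _) (ltW r0) ar.
  by rewrite pseriesEord big_ord0.
exists (M / r ^+ n) => [|x l xr al]; first by rewrite divr_ge0 ?exprn_ge0// ltW.
have cv : (fun N => `|pseries a x N - \sum_(k < n) a k * x ^+ k|) @ \oo -->
    `|l - \sum_(k < n) a k * x ^+ k|.
  by apply: cvg_norm; apply: cvgB => //; exact: cvg_cst.
rewrite -(cvg_lim _ cv)//; apply: limr_le; first exact: (cvgP _ cv).
near=> N.
have nN : (n <= N)%N by near: N; exact: nbhs_infty_ge.
rewrite pseriesEord -!(big_mkord xpredT (fun k => a k * x ^+ k)).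
rewrite (big_cat_nat _ nN)//= addrAC subrr add0r.
apply: (le_trans (ler_norm_sum _ _ _)).
have -> : M / r ^+ n * `|x| ^+ n = (`|x| / r) ^+ n * M.
  by rewrite expr_div_n; ring.
have xr0 : 0 <= `|x| / r by rewrite divr_ge0// ltW.
have le : \sum_(n <= k < N) `|a k| * r ^+ k <= M.
  have := @pseries_le_lim (fun k => `|a k|) r N (fun k => normr_ge0 _) (ltW r0) ar.
  rewrite pseriesEord -(big_mkord xpredT (fun k => `|a k| * r ^+ k)).
  rewrite (big_cat_nat _ nN)//=; apply: le_trans.
  by rewrite lerDr sumr_ge0// => i _; rewrite mulr_ge0 ?exprn_ge0// ltW.
apply: le_trans (ler_wpM2l (exprn_ge0 n xr0) le).
rewrite mulr_sumr; apply: ler_sum_nat => k /andP[nk _].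
rewrite normrM normrX mulrCA ler_wpM2l//.
have -> : `|x| ^+ k = (`|x| / r) ^+ k * r ^+ k.
  by rewrite -exprMn divfK ?gt_eqF.
rewrite ler_wpM2r ?exprn_ge0 ?(ltW r0)//.
by apply: ler_wiXn2l => //; rewrite ler_pdivrMr ?mul1r.
Unshelve. all: by end_near. Qed.

(** If a_k were the first nonzero coefficient, the sum would be equivalent to
    a_k t^k at 0, against a bound in t^(k+1).  Estimates for t > 0 suffice,
    which is what is available when a function is known on one side of 0. *)
Lemma flat_pseries_eq0 a r : 0 < r -> cvgn (pseries (fun k => `|a k|) r) ->
  (forall n, exists C : R, exists2 d : R, 0 < d & forall t (l : R), 0 < t < d ->
     pseries a t @ \oo --> l -> `|l| <= C * t ^+ n) ->
  forall k, a k = 0.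
Proof.
move=> r0 ar flat k; elim/ltn_ind: k => k IH; apply/eqP; apply/negPn/negP => ak.
have [C C0 HC] := @pseries_remainder a r k.+1 r0 ar.
have [D [d d0 HD]] := flat k.+1.
set E := C + `|D| + 1.
have E0 : 0 < E by rewrite /E; have := normr_ge0 D; lra.
have ak0 : 0 < `|a k| by rewrite normr_gt0.
(* small enough for both bounds and for E t <= |a_k|, where E > C + D *)
pose t := Num.min (Num.min (r / 2) (d / 2)) (`|a k| / E).
have t0 : 0 < t by rewrite !lt_min !divr_gt0.
have tr : t <= r / 2 by rewrite !ge_min lexx.
have td : t <= d / 2 by rewrite !ge_min lexx orbT.
have tE : t <= `|a k| / E by rewrite ge_min lexx orbT.
have tn : `|t| = t by rewrite gtr0_norm.
have cv : pseries a t @ \oo --> limn (pseries a t).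
  apply: (@is_cvg_pseries_inside _ _ r); last by rewrite tn (gtr0_norm r0); lra.
  by apply: normed_cvg; move: ar; rewrite /normed_series_of /pseries /=;
   under eq_fun do rewrite -[X in _ * X](ger0_norm (exprn_ge0 _ (ltW r0))) -normrM.
have h1 : 0 < t < d by rewrite t0; lra.
have := HD _ _ h1 cv; have /HC := cv.
rewrite tn => /(_ ltac:(lra)); rewrite big_ord_recr /= big1 ?add0r; last first.
  by move=> i _; rewrite IH ?mul0r.
set l := limn _ => HC1 HD1.
have : `|a k| * t ^+ k <= (C + D) * t ^+ k.+1.
  rewrite -(ger0_norm (exprn_ge0 k (ltW t0))) -normrM mulrDl.
  have -> : a k * t ^+ k = l - (l - a k * t ^+ k) by ring.
  by rewrite (le_trans (ler_normB _ _))// addrC lerD.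
rewrite exprS mulrA ler_pM2r ?exprn_gt0// => le.
have : t * E <= `|a k| by rewrite -ler_pdivlMr.
rewrite /E; have := ler_norm D; nra.
Unshelve. all: by end_near. Qed.

End PowerSeries.

(** * Uniqueness and recentering of power series *)

Section PowerSeries2.
Context {R : realType}.
Implicit Types (alpha : \bar R) (a b : R^nat) (f : R -> R) (x y h c r : R).

Lemma cvg_sum_ord (n : nat) (u : nat -> R^nat) (l : R^nat) :
  (forall j, (j < n)%N -> u j @ \oo --> l j) ->
  (fun N => \sum_(j < n) u j N) @ \oo --> \sum_(j < n) l j.
Proof.
by move=> ul; apply: cvg_big => [|i _]; [exact: add_continuous|exact: ul].
Qed.

Lemma cvg_pseries_coef_eq0 a n x : (forall k, (n <= k)%N -> a k = 0) ->
  pseries a x @ \oo --> \sum_(k < n) a k * x ^+ k.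
Proof.
move=> a0; apply: cvg_near_cst; near=> N.
have nN : (n <= N)%N by near: N; exact: nbhs_infty_ge.
rewrite pseriesEord -!(big_mkord xpredT (fun k => a k * x ^+ k)).
rewrite (big_cat_nat _ nN)//= [X in _ + X]big_nat [X in _ + X]big1 ?addr0// => k /andP[nk _].
by rewrite a0 ?mul0r.
Unshelve. all: by end_near. Qed.

Lemma pseriesB a b x : pseries (fun k => a k - b k) x = pseries a x - pseries b x.
Proof.
apply/funext => n; rewrite -[RHS]/(pseries a x n - pseries b x n).
by rewrite !pseriesEord -sumrB; apply: eq_bigr => i _; rewrite mulrBl.
Qed.

Lemma pseriesD a b x : pseries (fun k => a k + b k) x = pseries a x + pseries b x.
Proof.
apply/funext => n; rewrite -[RHS]/(pseries a x n + pseries b x n).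
by rewrite !pseriesEord -big_split; apply: eq_bigr => i _; rewrite mulrDl.
Qed.

Lemma pseries_comp_mul a c x :
  pseries (fun k => c ^+ k * a k) x = pseries a (c * x).
Proof.
apply/funext => n; rewrite !pseriesEord; apply: eq_bigr => i _.
by rewrite exprMn; ring.
Qed.

Lemma power_seriesB alpha a b f (g : R -> R) : power_series_on alpha a f ->
  power_series_on alpha b g ->
  power_series_on alpha (fun k => a k - b k) (fun x => f x - g x).
Proof.
by move=> af bg x xa; rewrite pseriesB; apply: cvgB; [exact: af|exact: bg].
Qed.

Lemma power_seriesD alpha a b f (g : R -> R) : power_series_on alpha a f ->
  power_series_on alpha b g ->
  power_series_on alpha (fun k => a k + b k) (fun x => f x + g x).
Proof.
by move=> af bg x xa; rewrite pseriesD; apply: cvgD; [exact: af|exact: bg].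
Qed.

Lemma power_series_on_scale alpha a f s : `|s| <= 1 ->
  power_series_on alpha a f ->
  power_series_on alpha (fun k => s ^+ k * a k) (fun x => f (s * x)).
Proof.
move=> s1 af x xa; rewrite pseries_comp_mul; apply: af.
by apply: sym_itv_le xa; rewrite normrM ler_piMl.
Qed.

(** The sign s selects the side of 0 on which the two sums are known to agree:
    at an endpoint of an interval there is only one side. *)
Lemma power_series_on_unique a b f (g : R -> R) (s r d : R) : 0 < r -> 0 < d -> `|s| = 1 ->
  power_series_on r%:E a f -> power_series_on r%:E b g ->
  (forall t, 0 < t < d -> f (s * t) = g (s * t)) -> a = b.
Proof.
move=> r0 d0 s1 af bg fg; have s1' : `|s| <= 1 by rewrite s1.
have pc := power_seriesB (power_series_on_scale s1' af) (power_series_on_scale s1' bg).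
have r2 : 0 < r / 2 by rewrite divr_gt0.
have r2r : sym_itv r%:E (r / 2).
  by apply/sym_itv_fin; rewrite gtr0_norm//; lra.
have := is_cvg_pseries_norm pc r2r; rewrite gtr0_norm// => cv.
have sN0 : s != 0 by rewrite -normr_eq0 s1 oner_eq0.
have c0 := flat_pseries_eq0 r2 cv.
apply/funext => k; apply: (mulfI (expf_neq0 k sN0)); apply: subr0_eq; apply: c0 => n.
exists 0, (Num.min d r).
  by rewrite lt_min d0.
move=> t l /andP[t0]; rewrite lt_min => /andP[td tr] tl.
have tI : sym_itv r%:E t by apply/sym_itv_fin; rewrite gtr0_norm.
rewrite mul0r -(cvg_lim _ tl)//; have := pc _ tI.
by rewrite fg ?t0// subrr => /(cvg_lim (@Rhausdorff R)) ->; rewrite normr0.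
Qed.

Lemma binom_term_le x y k j : 0 <= x -> 0 <= y ->
  'C(k, j)%:R * x ^+ (k - j) * y ^+ j <= (x + y) ^+ k.
Proof.
move=> x0 y0; have [jk|kj] := leqP j k; last first.
  by rewrite bin_small// !mul0r exprn_ge0// addr_ge0.
rewrite exprDn (bigD1 (Ordinal (jk : (j < k.+1)%N)))//= -mulrA mulr_natl.
by rewrite lerDl sumr_ge0// => i _; rewrite mulrn_wge0// mulr_ge0 ?exprn_ge0.
Qed.

Lemma exprDn_wide x y k m : (k < m)%N ->
  (x + y) ^+ k = \sum_(0 <= j < m) 'C(k, j)%:R * x ^+ (k - j) * y ^+ j.
Proof.
move=> km; rewrite exprDn -(big_mkord xpredT (fun j => x ^+ (k - j) * y ^+ j *+ 'C(k, j))).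
rewrite (big_cat_nat (n := k.+1) _ km)//= [X in _ = _ + X]big_nat.
rewrite [X in _ = _ + X]big1 ?addr0; last first.
  by move=> j /andP[kj _]; rewrite bin_small// !mul0r.
by apply: eq_bigr => j _; rewrite -mulrA mulr_natl.
Qed.

(** Replacing h by H in the term of index j >= n costs a factor
    (|h| / H)^j <= (|h| / H)^n; the terms with H then add up to a part of
    (|x| + H)^k. *)
Lemma binom_tail_le x h H k n : 0 < H -> `|h| <= H ->
  `|(x + h) ^+ k - \sum_(j < n) 'C(k, j)%:R * x ^+ (k - j) * h ^+ j|
    <= (`|h| / H) ^+ n * (`|x| + H) ^+ k.
Proof.
move=> H0 hH; set m := (n + k.+1)%N.
have km : (k < m)%N by rewrite /m; lia.
have nm : (n <= m)%N by rewrite /m; lia.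
rewrite (exprDn_wide _ _ km) (exprDn_wide _ _ km).
rewrite -(big_mkord xpredT (fun j => 'C(k, j)%:R * x ^+ (k - j) * h ^+ j)).
rewrite (big_cat_nat _ nm)//= addrAC subrr add0r.
apply: (le_trans (ler_norm_sum _ _ _)).
have q0 : 0 <= `|h| / H by rewrite divr_ge0// ltW.
have : \sum_(n <= j < m) 'C(k, j)%:R * `|x| ^+ (k - j) * H ^+ j
    <= \sum_(0 <= j < m) 'C(k, j)%:R * `|x| ^+ (k - j) * H ^+ j.
  rewrite [leRHS](big_cat_nat (n := n) _ nm)//= lerDr sumr_ge0// => i _.
  by rewrite !mulr_ge0 ?exprn_ge0// ltW.
move/(ler_wpM2l (exprn_ge0 n q0)); apply: le_trans.
rewrite mulr_sumr; apply: ler_sum_nat => j /andP[nj _].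
rewrite !normrM !normrX normr_nat [leRHS]mulrCA ler_wpM2l ?mulr_ge0 ?exprn_ge0//.
have -> : `|h| ^+ j = (`|h| / H) ^+ j * H ^+ j by rewrite -exprMn divfK ?gt_eqF.
rewrite ler_wpM2r ?exprn_ge0 ?(ltW H0)//.
by apply: ler_wiXn2l => //; rewrite ler_pdivrMr ?mul1r.
Qed.

(** Expand (c + h)^k by the binomial formula.  No double series is rearranged:
    cutting each binomial expansion at the order n changes the sum of the
    a_k (c + h)^k by at most (|h| / H)^n times the sum of the
    |a_k| (|c| + H)^k, for any H > |h| with |c| + H inside the interval. *)
Lemma pseries_recenter alpha a f c : power_series_on alpha a f ->
  sym_itv alpha c -> exists2 A : R^nat,
  (forall j, series (fun k => 'C(k, j)%:R * c ^+ (k - j) * a k) @ \oo --> A j) &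
  (forall h, sym_itv alpha (`|c| + `|h|) -> pseries A h @ \oo --> f (c + h)).
Proof.
move=> af ca; pose T j k := 'C(k, j)%:R * c ^+ (k - j) * a k.
have Tcv j : cvgn (series (T j)).
  have [r cr ra] := sym_itv_room ca; have cn := normr_ge0 c.
  have H0 : 0 < r - `|c| by rewrite subr_gt0.
  have r0 : 0 < r by lra.
  apply: normed_cvg; rewrite /normed_series_of.
  apply: (@series_le_cvg _ _ (fun k => (r - `|c|) ^- j * (`|a k| * `|r| ^+ k))).
  - by move=> n; exact: normr_ge0.
  - by move=> n; rewrite mulr_ge0 ?invr_ge0 ?exprn_ge0 ?mulr_ge0 ?exprn_ge0 ?(ltW H0).
  - move=> k; rewrite /= /T !normrM normrX normr_nat [leLHS]mulrC [leRHS]mulrCA ler_wpM2l//.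
    rewrite [leRHS]mulrC ler_pdivlMr ?exprn_gt0//.
    have := @binom_term_le `|c| (r - `|c|) k j cn (ltW H0).
    by rewrite addrCA subrr addr0 (gtr0_norm r0).
  - exact/is_cvg_seriesZ/(is_cvg_pseries_norm af ra).
exists (fun j => limn (series (T j))) => // h ha.
set A := fun j => _; have TA j : series (T j) @ \oo --> A j by exact: Tcv.
have [r hr ra] := sym_itv_room ha; have cn := normr_ge0 c; have hn := normr_ge0 h.
rewrite ger0_norm in hr; last by rewrite addr_ge0.
pose H := r - `|c|; have hH : `|h| < H by rewrite /H; lra.
have H0 : 0 < H by lra.
have r0 : 0 < r by lra.
pose M := limn (pseries (fun k => `|a k|) r).
have q0 : 0 <= `|h| / H by rewrite divr_ge0 ?(ltW H0).
have q1 : `|(`|h| / H)| < 1 by rewrite ger0_norm// ltr_pdivrMr ?mul1r.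
have key n : `|f (c + h) - pseries A h n| <= (`|h| / H) ^+ n * M.
  have cv1 : pseries a (c + h) @ \oo --> f (c + h).
    apply: af; apply: sym_itv_le ha.
    by rewrite [leRHS]ger0_norm ?addr_ge0// ler_normD.
  have cv2 : (fun N => \sum_(j < n) series (T j) N * h ^+ j) @ \oo --> pseries A h n.
    rewrite pseriesEord.
    apply: (@cvg_sum_ord n (fun j N => series (T j) N * h ^+ j) (fun j => A j * h ^+ j)).
    by move=> j _; apply: cvgMr_tmp; exact: TA.
  have cv3 : (fun N => `|pseries a (c + h) N - \sum_(j < n) series (T j) N * h ^+ j|)
      @ \oo --> `|f (c + h) - pseries A h n| by apply: cvg_norm; exact: cvgB.
  refine (ler_cvg_to cv3 (cvg_cst ((`|h| / H) ^+ n * M)) _); near=> N.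
  have -> : pseries a (c + h) N - \sum_(j < n) series (T j) N * h ^+ j =
    \sum_(k < N) a k * ((c + h) ^+ k - \sum_(j < n) 'C(k, j)%:R * c ^+ (k - j) * h ^+ j).
    rewrite pseriesEord.
    under [X in _ - X]eq_bigr do rewrite seriesEord /= mulr_suml.
    rewrite exchange_big -sumrB; apply: eq_bigr => k _.
    rewrite mulrBr; congr (_ - _); rewrite mulr_sumr; apply: eq_bigr => j _.
    by rewrite /T; ring.
  apply: (le_trans (ler_norm_sum _ _ _)).
  have aM : pseries (fun k => `|a k|) r N <= M.
    apply: pseries_le_lim => //; first exact: ltW.
    by have := is_cvg_pseries_norm af ra; rewrite (gtr0_norm r0).
  apply: le_trans (ler_wpM2l (exprn_ge0 n q0) aM).
  rewrite pseriesEord mulr_sumr; apply: ler_sum => k _.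
  rewrite normrM mulrCA ler_wpM2l//.
  have := @binom_tail_le c h H k n H0 (ltW hH).
  by rewrite /H addrCA subrr addr0.
have cvq : (fun n => (`|h| / H) ^+ n * M) @ \oo --> (0 : R).
  by rewrite -[X in _ --> X](mul0r M); apply: cvgMr_tmp; exact: cvg_expr.
apply/subr_cvg0/norm_cvg0P; apply: squeeze_cvgr (cvg_cst 0) cvq.
by near=> n; rewrite normr_ge0 distrC; exact: key.
Unshelve. all: by end_near. Qed.

End PowerSeries2.

(** * Real analyticity and Pringsheim's principle *)

Section Analytic.
Context {R : realType}.
Implicit Types (alpha : \bar R) (a b : R^nat) (f : R -> R) (x y h c r : R).

Lemma sub_power_series_on alpha beta a f :
  (forall x, sym_itv beta x -> sym_itv alpha x) ->
  power_series_on alpha a f -> power_series_on beta a f.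
Proof. by move=> ba af x /ba /af. Qed.

Lemma power_series_on_lim alpha a f : power_series_on alpha a f ->
  forall x, sym_itv alpha x -> limn (pseries a x) = f x.
Proof. by move=> af x /af /(cvg_lim (@Rhausdorff R)). Qed.

(** Up to a shift, the derived series at x is the coefficient of index 1 in the
    expansion around x. *)
Lemma cvg_pseries_diffs alpha a f x : power_series_on alpha a f ->
  sym_itv alpha x -> cvgn (pseries (pseries_diffs a) x).
Proof.
move=> af xa; have [A /(_ 1%N) A1 _] := pseries_recenter af xa.
apply/cvg_ex; exists (A 1%N); move: A1; rewrite -cvg_shiftS.
apply: cvg_trans; apply: near_eq_cvg; near=> n.
rewrite /= seriesEord /= pseriesEord big_ord_recl /= bin_small// !mul0r add0r.
by apply: eq_bigr => i _; rewrite /bump /= add1n bin1 subSS subn0 /pseries_diffs; ring.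
Unshelve. all: by end_near. Qed.

Lemma power_series_derive1 r a f : power_series_on r%:E a f ->
  power_series_on r%:E (pseries_diffs a) (derive1 f).
Proof.
move=> af; pose g x := limn (pseries (pseries_diffs a) x).
have ag : power_series_on r%:E (pseries_diffs a) g.
  by move=> x xr; exact: cvg_pseries_diffs af xr.
move=> x xr; suff -> : derive1 f x = g x by exact: ag.
have [s xs sr] := sym_itv_room xr.
have D : is_derive x (1 : R) (fun x => limn (pseries a x)) (g x).
  apply: (@pseries_snd_diffs _ _ s).
  - by apply/cvg_ex; exists (f s); exact: af.
  - exact: ag.
  - exact: cvg_pseries_diffs ag sr.
  - by rewrite (lt_le_trans xs) ?ler_norm.
have : is_derive x (1 : R) f (g x).
  apply: near_eq_is_derive D; near=> y; apply: (power_series_on_lim af).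
  apply/sym_itv_fin; near: y; apply: (cvgr_lt `|x|); last exact/sym_itv_fin.
  exact: cvg_norm.
by rewrite derive1E => /@derive_val.
Unshelve. all: by end_near. Qed.

Lemma power_series_at0 alpha a f : (0 < alpha)%E -> power_series_on alpha a f ->
  f 0 = a 0%N.
Proof.
move=> alpha0 af; rewrite -(power_series_on_lim af); last first.
  by apply/sym_itvE; rewrite normr0.
apply: cvg_lim => //; apply: cvg_near_cst; near=> n.
have n0 : (0 < n)%N by near: n; exact: nbhs_infty_gt.
rewrite pseriesEord; rewrite -(prednK n0).
rewrite big_ord_recl mulr1 big1 ?addr0// => i _.
by rewrite expr0n mulr0.
Unshelve. all: by end_near. Qed.

Lemma derive1n_power_series r a f k : 0 < r -> power_series_on r%:E a f ->
  derive1n k f 0 = k`!%:R * a k.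
Proof.
move=> r0; elim: k a f => [|k IH] a f af.
  by rewrite derive1n0 mul1r (power_series_at0 _ af) ?lte_fin.
rewrite /derive1n iterSr -/(derive1n k _) (IH _ _ (power_series_derive1 af)).
by rewrite /pseries_diffs factS natrM mulrA [k.+1%:R * _]mulrC.
Qed.

Lemma real_analytic_onP (D : set R) f : real_analytic_on D f <->
  forall c, D c -> exists a, exists2 r : R, 0 < r &
    power_series_on r%:E a (fun h => f (c + h)).
Proof.
split=> [fD c /fD [a]|H c /H [a [r r0 af]]].
  move=> /nbhs_ballP [r /= r0 H]; exists a, r => // h /sym_itv_fin hr.
  have := H (c + h); rewrite /ball /= opprD addNKr normrN => /(_ hr).
  by rewrite addrAC subrr add0r.
exists a; apply/nbhs_ballP; exists r => //= x; rewrite /ball /= distrC => xr.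
have := af (x - c); rewrite addrCA subrr addr0; apply; exact/sym_itv_fin.
Qed.

Lemma power_series_analytic alpha a f : power_series_on alpha a f ->
  real_analytic_on (sym_itv alpha) f.
Proof.
move=> af; apply/real_analytic_onP => c ca.
have [A _ HA] := pseries_recenter af ca; have [r cr ra] := sym_itv_room ca.
exists A, (r - `|c|) => [|h /sym_itv_fin hr]; first by rewrite subr_gt0.
apply: HA; apply: sym_itv_le ra.
by rewrite ger0_norm ?addr_ge0// (le_trans _ (ler_norm r))//; lra.
Qed.

(** Around the endpoint s t of the interval of radius t both f and F are power
    series, and they agree on the side facing 0. *)
Lemma agree_near_endpoint a b f (F : R -> R) t d s : 0 < t ->
  power_series_on (t + d)%:E a F -> power_series_on d%:E b (fun h => f (s * t + h)) ->
  0 < d -> `|s| = 1 ->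
  (forall x, sym_itv t%:E x -> f x = F x) ->
  forall h, `|h| < d -> f (s * t + h) = F (s * t + h).
Proof.
move=> tp aF bf d0 s1 fF h hd; have t0 := ltW tp.
have stn : `|s * t| = t by rewrite normrM s1 mul1r ger0_norm.
have [|B _ HB] := @pseries_recenter _ _ _ _ (s * t) aF.
  by apply/sym_itv_fin; rewrite stn; lra.
have BF : power_series_on d%:E B (fun h => F (s * t + h)).
  move=> x /sym_itv_fin xd; apply: HB; apply/sym_itv_fin.
  by rewrite stn ger0_norm ?addr_ge0//; lra.
have hI : sym_itv d%:E h by apply/sym_itv_fin.
suff E : B = b.
  by rewrite -(power_series_on_lim bf hI) -(power_series_on_lim BF hI) E.
apply: (@power_series_on_unique _ _ _ _ _ (- s) d t d0 tp _ BF bf) => [|x /andP[x0 xt]].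
  by rewrite normrN.
rewrite fF//; apply/sym_itv_fin.
by rewrite mulNr -mulrBr normrM s1 mul1r gtr0_norm; lra.
Qed.

(** The heart of Pringsheim's principle.  From a point c = s - e slightly inside,
    the expansion of f around s shows that f is a power series on a disc that
    reaches beyond s.  By uniqueness its coefficients are the sums over k of
    'C(k, j) c^(k-j) a_k, which are nonnegative, so the partial sums of the
    a_k (s + e)^k are bounded by the value of that expansion at 2 e = s + e - c. *)
Lemma extend_power_series a b b' f s d : (forall k, 0 <= a k) -> 0 < s -> 0 < d ->
  power_series_on s%:E a f ->
  power_series_on d%:E b (fun h => f (s + h)) ->
  power_series_on d%:E b' (fun h => f (- s + h)) ->
  exists2 t : R, s < t & power_series_on t%:E a f.
Proof.
move=> a0 s0 d0 af bf bf'.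
pose e : R := Num.min d s / 4.
have e0 : 0 < e by rewrite divr_gt0// lt_min d0.
have ed : 4 * e <= d by rewrite mulrC divfK// ge_min lexx.
have es : 4 * e <= s by rewrite mulrC divfK// ge_min lexx orbT.
have [|A1 _ HA1] := @pseries_recenter _ _ _ _ (- e) bf.
  by apply/sym_itv_fin; rewrite normrN gtr0_norm//; lra.
have [|A2 TA2 HA2] := @pseries_recenter _ _ _ _ (s - e) af.
  by apply/sym_itv_fin; rewrite gtr0_norm; lra.
(* both are expansions of f around s - e, valid at least on |h| < e *)
have A12 : A1 = A2.
  pose fse h := f (s - e + h).
  apply: (@power_series_on_unique _ _ _ fse fse 1 e e) => //.
  - by rewrite normr1.
  - move=> h /sym_itv_fin he; rewrite /fse -addrA; apply: HA1; apply/sym_itv_fin.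
    by rewrite ger0_norm ?addr_ge0// normrN gtr0_norm//; lra.
  - move=> h /sym_itv_fin he; apply: HA2; apply/sym_itv_fin.
    by rewrite ger0_norm ?addr_ge0// gtr0_norm; lra.
pose T j k := 'C(k, j)%:R * (s - e) ^+ (k - j) * a k.
have se0 : 0 <= s - e by lra.
have T0 j k : 0 <= T j k by rewrite !mulr_ge0 ?exprn_ge0.
have Tle j N : series (T j) N <= A2 j.
  rewrite -(cvg_lim (@Rhausdorff R) (TA2 j)); apply: nondecreasing_cvgn_le.
    by apply/nondecreasing_seqP => n; rewrite seriesSr lerDl; exact: T0.
  by apply/cvg_ex; exists (A2 j); exact: TA2.
have A20 j : 0 <= A2 j by have := Tle j 0%N; rewrite seriesEord /= big_ord0.
have cv2 : cvgn (pseries A2 (2 * e)).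
  apply/cvg_ex; exists (f (s + (- e + 2 * e))); rewrite -A12; apply: HA1.
  by apply/sym_itv_fin; rewrite normrN !gtr0_norm; lra.
(* exchanging the two finite sums below is the only rearrangement *)
have cvt : cvgn (pseries a (s + e)).
  apply: nondecreasing_is_cvgn.
    by apply/nondecreasing_seqP => n; rewrite !pseriesEord big_ord_recr lerDl /=
      mulr_ge0// exprn_ge0//; lra.
  exists (limn (pseries A2 (2 * e))) => _ [N _ <-].
  apply: le_trans (pseries_le_lim N A20 _ cv2); last by lra.
  rewrite !pseriesEord.
  under eq_bigr => k _.
    have -> : s + e = (s - e) + 2 * e by ring.
    rewrite (exprDn_wide _ _ (ltn_ord k)) big_mkord mulr_sumr.
    over.
  rewrite exchange_big; apply: ler_sum => j _.
  apply: le_trans (ler_wpM2r _ (Tle j N)); last by rewrite exprn_ge0//; lra.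
  rewrite seriesEord mulr_suml; apply: ler_sum => k _.
  by rewrite le_eqVlt; apply/orP; left; apply/eqP; rewrite /T; ring.
pose F x := limn (pseries a x).
have aF : power_series_on (s + e)%:E a F.
  move=> x /sym_itv_fin xs; apply: is_cvg_pseries_inside cvt _.
  by rewrite (lt_le_trans xs) ?ler_norm.
have fF x : sym_itv s%:E x -> f x = F x by move=> xs; rewrite -(power_series_on_lim af xs).
have sub_ed g b0 : power_series_on d%:E b0 g -> power_series_on e%:E b0 g.
  by apply: sub_power_series_on => x /sym_itv_fin xe; apply/sym_itv_fin; lra.
exists (s + e) => [|x xse]; first by lra.
suff -> : f x = F x by exact: aF.
have [xs|sx] := ltP `|x| s; first by apply: fF; apply/sym_itv_fin.
move/sym_itv_fin: xse => xse.
have [x0|x0] := leP 0 x.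
  rewrite (ger0_norm x0) in sx xse.
  have -> : x = 1 * s + (x - s) by ring.
  apply: (agree_near_endpoint s0 aF (b := b)) => //; rewrite ?normr1//.
    by rewrite mul1r; exact: sub_ed.
  by rewrite ger0_norm; lra.
rewrite (ltr0_norm x0) in sx xse.
have -> : x = (-1) * s + (x + s) by ring.
apply: (agree_near_endpoint s0 aF (b := b')) => //; rewrite ?normrN1//.
  by rewrite mulN1r; exact: sub_ed.
by rewrite ler0_norm; lra.
Qed.

(** The supremum of the radii on which f is the sum of its series cannot lie
    inside the interval, by the previous lemma. *)
Lemma power_series_pringsheim alpha a f r : 0 < r -> (forall k, 0 <= a k) ->
  real_analytic_on (sym_itv alpha) f -> power_series_on r%:E a f ->
  power_series_on alpha a f.
Proof.
move=> r0 a0 /real_analytic_onP fa af x xa.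
apply: contrapT => xN; pose E := [set s : R | 0 < s /\ power_series_on s%:E a f].
have Ex s : E s -> s <= `|x|.
  move=> [s0 as_]; rewrite leNgt; apply/negP => xs; apply: xN; apply: as_.
  exact/sym_itv_fin.
have supE : has_sup E by split; [exists r|exists `|x|].
have rE : r <= sup E by apply: sup_ubound => //; case: supE.
have s0 : 0 < sup E by lra.
have sx : sup E <= `|x| by apply: ge_sup => //; case: supE.
have as_ : power_series_on (sup E)%:E a f.
  move=> y /sym_itv_fin ys.
  have [t [t0 at_] yt] := @sup_adherent _ E (sup E - `|y|) ltac:(by rewrite subr_gt0) supE.
  by apply: at_; apply/sym_itv_fin; lra.
have sa : sym_itv alpha (sup E) by apply: sym_itv_le xa; rewrite gtr0_norm.
have nsa : sym_itv alpha (- sup E) by apply: sym_itv_le xa; rewrite normrN gtr0_norm.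
have [b [d d0 bf]] := fa _ sa; have [b' [d' d0' bf']] := fa _ nsa.
have m0 : 0 < Num.min d d' by rewrite lt_min d0.
have [||t st at_] := @extend_power_series a b b' f _ _ a0 s0 m0 as_.
- apply: sub_power_series_on bf => y /sym_itv_fin; rewrite lt_min => /andP[? _].
  exact/sym_itv_fin.
- apply: sub_power_series_on bf' => y /sym_itv_fin; rewrite lt_min => /andP[_ ?].
  exact/sym_itv_fin.
have : t <= sup E by apply: sup_ubound; [case: supE|split => //; lra].
by rewrite leNgt st.
Qed.

(** The first K coefficients, of unknown sign, are subtracted as a polynomial
    before Pringsheim's principle is applied. *)
Lemma analytic_derive1n_ge0P K alpha f : (0 < alpha)%E ->
  real_analytic_on (sym_itv alpha) f /\
    (forall k, (K <= k)%N -> 0 <= derive1n k f 0) <->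
  exists2 a, power_series_on alpha a f & forall k, (K <= k)%N -> 0 <= a k.
Proof.
move=> alpha0; have a0 : sym_itv alpha (0 : R) by apply/sym_itvE; rewrite normr0.
split=> [[fan fd]|[a af ak]]; last first.
  split=> [|k Kk]; first exact: power_series_analytic af.
  have [r] := sym_itv_room a0; rewrite normr0 => r0 ra.
  rewrite (@derive1n_power_series r a) ?mulr_ge0 ?ak//.
  apply: sub_power_series_on af => x /sym_itv_fin xr; apply: sym_itv_le ra.
  by rewrite ltW// (lt_le_trans xr) ?ler_norm.
have /real_analytic_onP fan' := fan; have [a [r r0]] := fan' _ a0.
rewrite (_ : (fun _ => _) = f) => [af|]; last by apply/funext => x; rewrite add0r.
have ak k : (K <= k)%N -> 0 <= a k.
  by move=> /fd; rewrite (derive1n_power_series _ r0 af) pmulr_rge0// ltr0n fact_gt0.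
exists a => //; pose p k := if (k < K)%N then a k else 0.
pose P x := \sum_(k < K) p k * x ^+ k.
have pP beta : power_series_on beta p P.
  by move=> x _; apply: cvg_pseries_coef_eq0 => k Kk; rewrite /p ltnNge Kk.
suff ap : power_series_on alpha (fun k => a k - p k) (fun x => f x - P x).
  have := power_seriesD ap (pP alpha).
  by congr power_series_on; apply/funext => x; rewrite subrK.
apply: (power_series_pringsheim r0).
- move=> k; rewrite /p; case: ltnP => [_|/ak]; first by rewrite subrr.
  by rewrite subr0.
- apply/real_analytic_onP => c ca; have [b [d d0 bf]] := fan' _ ca.
  have /power_series_analytic/real_analytic_onP/(_ c) := pP (+oo%E).
  case=> [|b' [d' d0' bf']]; first by apply/sym_itvE; rewrite ltry.
  exists (fun k => b k - b' k), (Num.min d d'); first by rewrite lt_min d0.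
  apply: power_seriesB.
  + apply: sub_power_series_on bf => y /sym_itv_fin; rewrite lt_min => /andP[? _].
    exact/sym_itv_fin.
  + apply: sub_power_series_on bf' => y /sym_itv_fin; rewrite lt_min => /andP[_ ?].
    exact/sym_itv_fin.
- exact: power_seriesB af (pP _).
Qed.

End Analytic.

(** * Positive semidefinite matrices and the Schur product *)

Section Psd.
Context {R : realType}.
Implicit Types (n : nat).

Definition qform n (A : 'M[R]_n) (u : 'cV[R]_n) : R := (u^T *m A *m u) 0 0.

Lemma qformE n (A : 'M[R]_n) u :
  qform A u = \sum_i \sum_j u i 0 * A i j * u j 0.
Proof.
rewrite /qform mxE exchange_big; apply: eq_bigr => j _.
rewrite mxE mulr_suml; apply: eq_bigr => i _.
by rewrite !mxE.
Qed.

Lemma qformD n (A B : 'M[R]_n) u : qform (A + B) u = qform A u + qform B u.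
Proof. by rewrite /qform mulmxDr mulmxDl mxE. Qed.

Lemma qformB n (A B : 'M[R]_n) u : qform (A - B) u = qform A u - qform B u.
Proof. by rewrite /qform mulmxBr mulmxBl !mxE. Qed.

Lemma qformZ n (A : 'M[R]_n) c u : qform (c *: A) u = c * qform A u.
Proof. by rewrite /qform -scalemxAr -scalemxAl mxE. Qed.

Lemma qform_vecN n (A : 'M[R]_n) u : qform A (- u) = qform A u.
Proof. by rewrite !qformE; do 2!apply: eq_bigr => ? _; rewrite !mxE; ring. Qed.

Lemma qform_const1 n u : qform (const_mx 1 : 'M[R]_n) u = (\sum_i u i 0) ^+ 2.
Proof.
rewrite qformE expr2 mulr_suml; apply: eq_bigr => i _; rewrite mulr_sumr.
by apply: eq_bigr => j _; rewrite mxE mulr1.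
Qed.

Lemma qform_outer n (w u : 'cV[R]_n) : qform (w *m w^T) u = ((w^T *m u) 0 0) ^+ 2.
Proof.
rewrite /qform mulmxA -mulmxA mxE big_ord1; rewrite expr2; congr (_ * _).
by rewrite -[u^T *m w]trmxK mxE trmx_mul trmxK.
Qed.

(** Moving u along the i-th basis vector: completing the square in t is what
    drives the elimination below. *)
Lemma qform_shift n (A : 'M[R]_n) u i t : A^T = A ->
  qform A (u - t *: delta_mx i 0) = qform A u - 2 * t * ((A *m u) i 0) + t ^+ 2 * A i i.
Proof.
move=> As; have e1 (w : 'cV[R]_n) : ((delta_mx i 0 : 'cV[R]_n)^T *m w) 0 0 = w i 0.
  by rewrite trmx_delta -rowE mxE.
have -> : qform A (u - t *: delta_mx i 0) =
   ((u^T - t *: (delta_mx i 0)^T) *m A *m (u - t *: delta_mx i 0)) 0 0.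
  by rewrite /qform [(_ - _)^T]linearB /= [(t *: _)^T]linearZ.
have Q1 : ((delta_mx i 0 : 'cV[R]_n)^T *m (A *m u)) 0 0 = (A *m u) i 0 by exact: e1.
have Q2 : (u^T *m (A *m (delta_mx i 0 : 'cV[R]_n))) 0 0 = (A *m u) i 0.
  have -> : u^T *m (A *m (delta_mx i 0 : 'cV[R]_n)) = ((delta_mx i 0)^T *m (A *m u))^T.
    by rewrite !trmx_mul As trmxK mulmxA.
  by rewrite mxE; exact: e1.
have Q3 : ((delta_mx i 0 : 'cV[R]_n)^T *m (A *m (delta_mx i 0 : 'cV[R]_n))) 0 0 = A i i.
  by rewrite e1 -colE mxE.
rewrite /qform !mulmxBl !mulmxBr -!scalemxAl -!scalemxAr -!mulmxA.
move: Q1 Q2 Q3; move: (_ *m (A *m u)) (u^T *m (A *m (delta_mx i 0 : 'cV[R]_n))).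
move: (_ *m (A *m (delta_mx i 0 : 'cV[R]_n))) (u^T *m (A *m u)) ((A *m u) i 0) => M1 M2 q M3 M4.
by rewrite !mxE => -> -> ->; ring.
Qed.

Lemma psd0 n : psd (0 : 'M[R]_n).
Proof. by split=> [|u]; rewrite /symmetric_mx ?trmx0// mulmx0 mul0mx mxE. Qed.

Lemma psdD n (A B : 'M[R]_n) : psd A -> psd B -> psd (A + B).
Proof.
move=> [As A0] [Bs B0]; split=> [|u]; first by rewrite /symmetric_mx linearD /= As Bs.
by rewrite -/(qform _ _) qformD addr_ge0 ?A0 ?B0.
Qed.

Lemma psdZ n (A : 'M[R]_n) c : 0 <= c -> psd A -> psd (c *: A).
Proof.
move=> c0 [As A0]; split=> [|u]; first by rewrite /symmetric_mx linearZ /= As.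
by rewrite -/(qform _ _) qformZ mulr_ge0 ?A0.
Qed.

Lemma psd_const1 n : psd (const_mx 1 : 'M[R]_n).
Proof.
split=> [|u]; first exact: trmx_const.
by rewrite -/(qform _ _) qform_const1 sqr_ge0.
Qed.

Lemma psd_diag_ge0 n (A : 'M[R]_n) i : psd A -> 0 <= A i i.
Proof.
move=> [As /(_ (0 - (1 : R) *: delta_mx i 0))]; rewrite -/(qform _ _) qform_shift//.
by rewrite mulmx0 /qform mulmx0 !mxE mulr0 subr0 add0r expr1n mul1r.
Qed.

(** Otherwise the form at e_j - t e_i would be affine in t with a nonzero slope,
    so negative for some t. *)
Lemma psd_diag_eq0 n (A : 'M[R]_n) i j : psd A -> A i i = 0 -> A i j = 0.
Proof.
move=> [As A0] Aii; apply/eqP; apply/negPn/negP => Aij.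
(* the form at e_j - t e_i is then A_jj - 2 t A_ij = -1 *)
pose t := (A j j + 1) / (2 * A i j).
have := A0 (delta_mx j 0 - t *: delta_mx i 0); rewrite -/(qform _ _) qform_shift//.
have := @qform_shift n A 0 j (-1) As; rewrite sub0r scaleN1r opprK => ->.
rewrite -colE /qform !mulmx0 !mxE Aii /t.
have -> : 0 - 2 * -1 * 0 + (-1) ^+ 2 * A j j -
   2 * ((A j j + 1) / (2 * A i j)) * A i j + ((A j j + 1) / (2 * A i j)) ^+ 2 * 0
   = - 1 by field.
by rewrite oppr_ge0 ler10.
Qed.

Definition hadamard n (A B : 'M[R]_n) : 'M[R]_n := \matrix_(i, j) (A i j * B i j).

(** The form at u is the form of A at the entrywise product of u and w. *)
Lemma psd_hadamard_outer n (A : 'M[R]_n) (w : 'cV[R]_n) : psd A ->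
  psd (hadamard A (w *m w^T)).
Proof.
move=> [As A0]; split=> [|u].
  apply/matrixP => i j; rewrite !mxE !big_ord1 !mxE mulrC [RHS]mulrC.
  by rewrite -[in LHS]As mxE [w j 0 * _]mulrC.
rewrite -/(qform _ _).
have -> : qform (hadamard A (w *m w^T)) u = qform A (\col_i (u i 0 * w i 0)).
  by rewrite !qformE; do 2!apply: eq_bigr => ? _; rewrite !mxE big_ord1 !mxE; ring.
exact: A0.
Qed.

(** One step of Gaussian elimination: at u, the form of the difference is the
    form of B at u - t e_i for the t that minimizes it. *)
Lemma psd_sub_outer n (B : 'M[R]_n) i : psd B -> 0 < B i i ->
  psd (B - (B i i)^-1 *: (col i B *m (col i B)^T)).
Proof.
move=> [Bs B0] Bii; split=> [|u].
  by rewrite /symmetric_mx linearB /= linearZ /= trmx_mul trmxK Bs.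
rewrite -/(qform _ _) qformB qformZ qform_outer.
have -> : ((col i B)^T *m u) 0 0 = (B *m u) i 0.
  by rewrite tr_col Bs -row_mul mxE.
have := B0 (u - ((B *m u) i 0 / B i i) *: delta_mx i 0).
rewrite -/(qform _ _) qform_shift//; congr (_ <= _).
by field; rewrite gt_eqF.
Qed.

(** Schur's product theorem.  Elimination peels rank one matrices off B, for
    which the claim is clear; it clears a diagonal entry and creates none, so
    the number of nonzero diagonal entries is a measure of progress. *)
Lemma psd_hadamard n (A B : 'M[R]_n) : psd A -> psd B -> psd (hadamard A B).
Proof.
move=> pA; have [m] := ubnP #|[pred i | B i i != 0]|.
elim: m B => // m IH B Bm pB.
have [i Bi|B0] := pickP [pred i | B i i != 0]; last first.
  suff -> : hadamard A B = 0 by exact: psd0.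
  apply/matrixP => i j; rewrite !mxE (psd_diag_eq0 _ pB) ?mulr0//.
  by have /negbFE/eqP := B0 i.
have Bii : 0 < B i i by rewrite lt_def psd_diag_ge0 ?andbT.
have pB' := psd_sub_outer pB Bii; set B' := B - _ in pB'.
have -> : hadamard A B =
    hadamard A B' + (B i i)^-1 *: hadamard A (col i B *m (col i B)^T).
  by apply/matrixP => k l; rewrite !mxE big_ord1 !mxE; ring.
apply: psdD; last by apply: psdZ (psd_hadamard_outer _ pA); rewrite invr_ge0 ltW.
apply: (IH _ _ pB'); rewrite -ltnS; apply: leq_trans Bm; rewrite ltnS; apply: proper_card.
have B'le k : B' k k <= B k k.
  by rewrite !mxE big_ord1 !mxE gerBl mulr_ge0 ?invr_ge0 ?(ltW Bii)// -expr2 sqr_ge0.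
apply/properP; split; last first.
  exists i; rewrite !inE// negbK !mxE big_ord1 !mxE mulrA mulVf// mul1r subrr//.
apply/fintype.subsetP => k; rewrite !inE; apply: contra => /eqP Bk.
by rewrite eq_le (psd_diag_ge0 k pB') andbT -Bk.
Qed.

Lemma psd_cvg n (M_ : nat -> 'M[R]_n) (M : 'M[R]_n) : (forall N, psd (M_ N)) ->
  (forall i j, (fun N => M_ N i j) @ \oo --> M i j) -> psd M.
Proof.
move=> M_psd M_M; split=> [|u].
  apply/matrixP => i j; rewrite mxE -(cvg_lim (@Rhausdorff R) (M_M i j)).
  rewrite -(cvg_lim (@Rhausdorff R) (M_M j i)); congr (limn _); apply/funext => N.
  by have [/matrixP/(_ i j)] := M_psd N; rewrite mxE.
rewrite -/(qform _ _).
have cv : (fun N => qform (M_ N) u) @ \oo --> qform M u.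
  rewrite qformE; under eq_fun do rewrite qformE.
  apply: cvg_big => [|i _]; first exact: add_continuous.
  apply: cvg_big => [|j _]; first exact: add_continuous.
  by apply: cvgMr_tmp; apply: cvgMl_tmp; exact: M_M.
apply: (ler_cvg_to (cvg_cst 0) cv); near=> N; exact: (M_psd N).2.
Unshelve. all: by end_near. Qed.

Lemma psd_series n (D : nat -> 'M[R]_n) (M : 'M[R]_n) : (forall k, psd (D k)) ->
  (forall i j, series (fun k => D k i j) @ \oo --> M i j) -> psd M.
Proof.
move=> Dp DM; apply: (@psd_cvg _ (fun N => \sum_(k < N) D k)) => [N|i j].
  by elim: N => [|N IH]; rewrite ?big_ord0 ?big_ord_recr; [exact: psd0|exact: psdD].
have := DM i j; rewrite seriesEord; apply: cvg_trans; apply: near_eq_cvg.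
by near=> N; rewrite summxE.
Unshelve. all: by end_near.
Qed.

Definition mx22 (x y : R) : 'M[R]_2 := \matrix_(i, j) if i == j then x else y.

Lemma psd_mx22 x y : psd (mx22 x y) <-> `|y| <= x.
Proof.
have qE u : qform (mx22 x y) u = x * (u 0 0 ^+ 2 + u 1 0 ^+ 2) + 2 * y * (u 0 0 * u 1 0).
  rewrite qformE !big_ord_recl !big_ord0 !mxE /=.
  have -> : lift ord0 ord0 = 1 :> 'I_2 by apply/val_inj.
  ring.
split=> [[_ xy]|xy]; last first.
  split=> [|u]; first by apply/matrixP => i j; rewrite !mxE eq_sym.
  rewrite -/(qform _ _) qE; move: xy; rewrite ler_norml => /andP[].
  have := sqr_ge0 (u 0 0 + u 1 0); have := sqr_ge0 (u 0 0 - u 1 0); nra.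
rewrite ler_norml; apply/andP; split.
  have := xy (\col_i 1); rewrite -/(qform _ _) qE !mxE; lra.
have := xy (\col_i (if i == 0 then 1 else -1)); rewrite -/(qform _ _) qE !mxE /=; lra.
Qed.

Lemma map_mx22 (f : R -> R) x y : map_mx f (mx22 x y) = mx22 (f x) (f y).
Proof. by apply/matrixP => i j; rewrite !mxE; case: ifP. Qed.

Lemma oppmxE (M : 'M[R]_1) : (- M) 0 0 = - M 0 0. Proof. by rewrite mxE. Qed.

Lemma qform_block n (P Q S : 'M[R]_n) u w :
  qform (block_mx P Q Q S) (col_mx u w) =
  qform P u + (u^T *m Q *m w) 0 0 + (w^T *m Q *m u) 0 0 + qform S w.
Proof.
rewrite /qform tr_col_mx mul_row_block mul_row_col !mulmxDl !mxE; ring.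
Qed.

Lemma qform_vecD n (Q : 'M[R]_n) u w :
  qform Q (u + w) = qform Q u + (u^T *m Q *m w) 0 0 + (w^T *m Q *m u) 0 0 + qform Q w.
Proof. by rewrite /qform [(u + w)^T]linearD /= !mulmxDr !mulmxDl !mxE; ring. Qed.

Lemma psd_block n (P Q S : 'M[R]_n) : P^T = P -> Q^T = Q -> S^T = S ->
  (forall u w, 0 <= qform (block_mx P Q Q S) (col_mx u w)) -> psd (block_mx P Q Q S).
Proof.
move=> Ps Qs Ss H; split=> [|u]; first by rewrite /symmetric_mx tr_block_mx Ps Qs Ss.
by rewrite -[u]vsubmxK; exact: H.
Qed.

(** At (u, w) the form is that of A at u + w plus c times the square of the sum
    of the coordinates of u. *)
Lemma psd_block_shift n (A : 'M[R]_n) c : 0 <= c -> psd A ->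
  psd (block_mx (A + const_mx c) A A A).
Proof.
move=> c0 [As A0]; have cE : const_mx c = c *: const_mx 1 :> 'M[R]_n.
  by apply/matrixP => i j; rewrite !mxE mulr1.
apply: psd_block => // [|u w]; first by rewrite linearD /= As trmx_const.
rewrite qform_block qformD cE qformZ qform_const1.
have := A0 (u + w); rewrite -/(qform _ _) qform_vecD.
have := mulr_ge0 c0 (sqr_ge0 (\sum_i u i 0)); lra.
Qed.

(** Test the block matrix on the vectors (u, - u). *)
Lemma psd_block_sub n (P Q : 'M[R]_n) : P^T = P -> Q^T = Q ->
  psd (block_mx P Q Q Q) -> psd (P - Q).
Proof.
move=> Ps Qs [_ H]; split=> [|u]; first by rewrite /symmetric_mx linearB /= Ps Qs.
have := H (col_mx u (- u)); rewrite -!/(qform _ _) qform_block qform_vecN qformB.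
by rewrite mulmxN [(- u)^T]linearN /= !mulNmx !oppmxE /qform; lra.
Qed.

(** At (u, w) the form is that of A at u - w. *)
Lemma psd_block_opp n (A : 'M[R]_n) : psd A -> psd (block_mx A (- A) (- A) A).
Proof.
move=> [As A0]; apply: psd_block => // [|u w]; first by rewrite linearN /= As.
have := A0 (u - w); rewrite -/(qform _ _) qform_vecD qform_block qform_vecN.
by rewrite !mulmxN [(- w)^T]linearN /= !mulNmx !oppmxE.
Qed.

(** Test the block matrix on the vectors (u, u) and (u, - u). *)
Lemma psd_block_sum n (P Q : 'M[R]_n) : P^T = P -> Q^T = Q ->
  psd (block_mx P Q Q P) -> psd (P + Q) /\ psd (P - Q).
Proof.
move=> Ps Qs [_ H]; split; split=> [|u].
- by rewrite /symmetric_mx linearD /= Ps Qs.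
- have := H (col_mx u u); rewrite -!/(qform _ _) qform_block qformD /qform; lra.
- by rewrite /symmetric_mx linearB /= Ps Qs.
have := H (col_mx u (- u)); rewrite -!/(qform _ _) qform_block qform_vecN qformB.
by rewrite mulmxN [(- u)^T]linearN /= !mulNmx !oppmxE /qform; lra.
Qed.

End Psd.

(** * Power series acting entrywise on matrices *)

Section Sufficiency.
Context {R : realType}.
Implicit Types (alpha : \bar R) (a : R^nat) (f : R -> R) (n : nat).

Definition hpow n k (A : 'M[R]_n) : 'M[R]_n := map_mx (fun x => x ^+ k) A.

Lemma hpowS n k (A : 'M[R]_n) : hpow k.+1 A = hadamard A (hpow k A).
Proof. by apply/matrixP => i j; rewrite !mxE exprS. Qed.

Lemma hpow0 n (A : 'M[R]_n) : hpow 0 A = const_mx 1.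
Proof. by apply/matrixP => i j; rewrite !mxE. Qed.

Lemma psd_hpow n k (A : 'M[R]_n) : psd A -> psd (hpow k A).
Proof.
by move=> pA; elim: k => [|k IH]; rewrite ?hpow0 ?hpowS; [exact: psd_const1|exact: psd_hadamard].
Qed.

(** A^(k+1) - B^(k+1) = (A - B) A^k + B (A^k - B^k) for entrywise products. *)
Lemma hpow_monotone n k (A B : 'M[R]_n) : psd B -> psd (A - B) ->
  psd (hpow k A - hpow k B).
Proof.
move=> pB pAB; have pA : psd A by rewrite -(subrK B A); exact: psdD.
elim: k => [|k IH]; first by rewrite !hpow0 subrr; exact: psd0.
have -> : hpow k.+1 A - hpow k.+1 B =
    hadamard (A - B) (hpow k A) + hadamard B (hpow k A - hpow k B).
  by apply/matrixP => i j; rewrite !mxE !exprS; ring.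
by apply: psdD; apply: psd_hadamard => //; exact: psd_hpow.
Qed.

(** Write C for the convex combination and D_k for the matrix in the conclusion.
    Entrywise, D_(k+1) = C D_k + l (1 - l) (A - B) (A^k - B^k). *)
Lemma hpow_convex n k (A B : 'M[R]_n) l : psd B -> psd (A - B) -> 0 <= l <= 1 ->
  psd (l *: hpow k A + (1 - l) *: hpow k B - hpow k (l *: A + (1 - l) *: B)).
Proof.
move=> pB pAB /andP[l0 l1]; have pA : psd A by rewrite -(subrK B A); exact: psdD.
have l1' : 0 <= 1 - l by rewrite subr_ge0.
set C := l *: A + (1 - l) *: B.
have pC : psd C by apply: psdD; exact: psdZ.
elim: k => [|k IH].
  by rewrite !hpow0 -scalerDl [l + _]addrCA subrr addr0 scale1r subrr; exact: psd0.
have -> : l *: hpow k.+1 A + (1 - l) *: hpow k.+1 B - hpow k.+1 C =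
    hadamard C (l *: hpow k A + (1 - l) *: hpow k B - hpow k C) +
    (l * (1 - l)) *: hadamard (A - B) (hpow k A - hpow k B).
  by apply/matrixP => i j; rewrite !mxE !exprS; ring.
apply: psdD; first exact: psd_hadamard.
by apply: psdZ; [exact: mulr_ge0|apply: psd_hadamard => //; exact: hpow_monotone].
Qed.

Lemma sym_itv_convex alpha (x y l : R) : 0 <= l <= 1 -> sym_itv alpha x ->
  sym_itv alpha y -> sym_itv alpha (l * x + (1 - l) * y).
Proof.
move=> /andP[l0 l1] xa ya.
have le m : `|x| <= m -> `|y| <= m -> `|l * x + (1 - l) * y| <= m.
  move=> xm ym; apply: (le_trans (ler_normD _ _)); rewrite !normrM.
  rewrite (ger0_norm l0) (@ger0_norm _ (1 - l)) ?subr_ge0//; nra.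
have [xy|yx] := leP `|x| `|y|; first exact: (sym_itv_le (le _ xy (lexx _)) ya).
exact: (sym_itv_le (le _ (lexx _) (ltW yx)) xa).
Qed.

Lemma power_series_S_positive alpha a f : power_series_on alpha a f ->
  (forall k, 0 <= a k) -> S_positive alpha f.
Proof.
move=> af a0 n _ A Aa pA; apply: (@psd_series _ _ (fun k => a k *: hpow k A)) => [k|i j].
  by apply: psdZ => //; exact: psd_hpow.
rewrite mxE (_ : (fun k => _) = (fun k => a k * A i j ^+ k)); first exact: af.
by apply/funext => k; rewrite !mxE.
Qed.

Lemma power_series_S_monotone alpha a f : power_series_on alpha a f ->
  (forall k, (1 <= k)%N -> 0 <= a k) -> S_monotone alpha f.
Proof.
move=> af a0 n _ A B _ _ Aa Ba AB pB; rewrite /loewner_le.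
apply: (@psd_series _ _ (fun k => a k *: (hpow k A - hpow k B))) => [k|i j].
  have [->|k0] := posnP k; first by rewrite !hpow0 subrr scaler0; exact: psd0.
  by apply: psdZ; [exact: a0|exact: hpow_monotone].
rewrite !mxE (_ : series _ = pseries a (A i j) - pseries a (B i j)).
  by apply: cvgB; exact: af.
apply/funext => N; rewrite -[RHS]/(pseries a (A i j) N - pseries a (B i j) N).
rewrite !pseriesEord seriesEord /= -sumrB.
by apply: eq_bigr => k _; rewrite !mxE; ring.
Qed.

Lemma power_series_S_convex alpha a f : power_series_on alpha a f ->
  (forall k, (2 <= k)%N -> 0 <= a k) -> S_convex alpha f.
Proof.
move=> af a0 n _ A B _ _ Aa Ba AB pB l l01; rewrite /loewner_le.
apply: (@psd_series _ _ (fun k => a k *: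
    (l *: hpow k A + (1 - l) *: hpow k B - hpow k (l *: A + (1 - l) *: B)))) => [k|i j].
  have [k2|k2] := leqP 2 k; first by apply: psdZ; [exact: a0|exact: hpow_convex].
  suff -> : l *: hpow k A + (1 - l) *: hpow k B - hpow k (l *: A + (1 - l) *: B) = 0.
    by rewrite scaler0; exact: psd0.
  by case: k k2 => [|[|]]// _; apply/matrixP => i j; rewrite !mxE ?expr0 ?expr1; ring.
have Ca := sym_itv_convex l01 (Aa i j) (Ba i j).
rewrite !mxE (_ : series _ = (fun N => l * pseries a (A i j) N +
    (1 - l) * pseries a (B i j) N - pseries a (l * A i j + (1 - l) * B i j) N)).
  apply: cvgB; last exact: af.
  by apply: cvgD; apply: cvgMl_tmp; exact: af.
apply/funext => N; rewrite !pseriesEord seriesEord /= !mulr_sumr -big_split -sumrB.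
by apply: eq_bigr => k _; rewrite !mxE /=; ring.
Qed.

End Sufficiency.

(** * First consequences of S-positivity *)

Section SPositive.
Context {R : realType}.
Implicit Types (alpha : \bar R) (f : R -> R) (b c x y : R).

Lemma S_positive_sub alpha beta f : (forall x, sym_itv beta x -> sym_itv alpha x) ->
  S_positive alpha f -> S_positive beta f.
Proof. by move=> ba fa n n0 A Ab; apply: fa => // i j; apply: ba. Qed.

(** The 2 x 2 matrix with diagonal x and off-diagonal y is positive
    semidefinite. *)
Lemma S_positive_norm_le alpha f x y : S_positive alpha f -> sym_itv alpha x ->
  `|y| <= x -> `|f y| <= f x.
Proof.
move=> fa xa yx; apply/psd_mx22; rewrite -map_mx22; apply: fa => //; last exact/psd_mx22.
move=> i j; rewrite mxE; case: ifP => // _; apply: sym_itv_le xa.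
exact: le_trans yx (ler_norm x).
Qed.

Definition fdiff c f y : R := f (y + c) - f y.

(** The substitute for differentiating f: the conclusion has the same form as
    the hypothesis, so the step can be iterated without any regularity of f. *)
Lemma S_positive_fdiff b c f : 0 <= c -> S_positive b%:E f ->
  S_positive (b - c)%:E (fdiff c f).
Proof.
move=> c0 fb n n0 A Ab pA.
have Ac i j : sym_itv b%:E (A i j + c).
  apply/sym_itv_fin; have /sym_itv_fin := Ab i j; have := ler_normD (A i j) c.
  by rewrite (ger0_norm c0); lra.
have Ab' i j : sym_itv b%:E (A i j).
  by apply/sym_itv_fin; have /sym_itv_fin := Ab i j; lra.
have As := pA.1.
have -> : map_mx (fdiff c f) A = map_mx f (A + const_mx c) - map_mx f A.
  by apply/matrixP => i j; rewrite !mxE.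
apply: psd_block_sub.
- by rewrite map_trmx linearD /= As trmx_const.
- by rewrite map_trmx As.
rewrite -map_block_mx; apply: fb; last exact: psd_block_shift.
  by rewrite addn_gt0 n0.
move=> i j; rewrite !mxE; case: (fintype.split i) => k; rewrite !mxE;
  by case: (fintype.split j) => l; rewrite ?mxE /=; exact: Ac || exact: Ab'.
Qed.

Lemma S_positive_iter_fdiff b c f k : 0 <= c -> S_positive b%:E f ->
  S_positive (b - k%:R * c)%:E (iter k (fdiff c) f).
Proof.
move=> c0 fb; elim: k => [|k IH]; first by rewrite mul0r subr0.
by have := S_positive_fdiff c0 IH; congr S_positive; congr _%:E; rewrite -natr1; ring.
Qed.

(** The block matrix with entries A, - A, - A, A is positive semidefinite. *)
Lemma S_positive_parity alpha f : S_positive alpha f ->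
  S_positive alpha (fun x => f x + f (- x)) /\
  S_positive alpha (fun x => f x - f (- x)).
Proof.
move=> fa; suff H n (A : 'M[R]_n) : (1 <= n)%N -> entries_in alpha A -> psd A ->
    psd (map_mx f A + map_mx f (- A)) /\ psd (map_mx f A - map_mx f (- A)).
  split=> n n0 A Aa pA.
    have := (H n A n0 Aa pA).1; congr psd; by apply/matrixP => i j; rewrite !mxE.
  have := (H n A n0 Aa pA).2; congr psd; by apply/matrixP => i j; rewrite !mxE.
move=> n0 Aa pA; have As := pA.1.
have nAa i j : sym_itv alpha (- A i j).
  by apply: sym_itv_le (Aa i j); rewrite normrN.
apply: psd_block_sum.
- by rewrite map_trmx As.
- by rewrite map_trmx linearN /= As.
rewrite -map_block_mx; apply: fa; last exact: psd_block_opp.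
  by rewrite addn_gt0 n0.
by move=> i j; rewrite !mxE; case: (fintype.split i) => k; rewrite !mxE;
  case: (fintype.split j) => l; rewrite ?mxE.
Qed.

End SPositive.

(** * Forward differences and Newton's formula *)

Section FiniteDifferences.
Context {R : realType}.
Implicit Types (f g : R -> R) (a : R^nat) (b c h x y : R).

Lemma iter_fdiffD k h f g x : iter k (fdiff h) (fun y => f y + g y) x =
  iter k (fdiff h) f x + iter k (fdiff h) g x.
Proof. by elim: k x => //= k IH x; rewrite /fdiff !IH; ring. Qed.

Lemma iter_fdiff_shift k h f t x :
  iter k (fdiff h) (fun y => f (y + t)) x = iter k (fdiff h) f (x + t).
Proof. by elim: k x => //= k IH x; rewrite /fdiff !IH addrAC. Qed.

Lemma pascal_sum (u : R^nat) n :
  \sum_(j < n.+2) 'C(n.+1, j)%:R * u j =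
  \sum_(j < n.+1) 'C(n, j)%:R * (u j + u j.+1).
Proof.
rewrite [RHS](eq_bigr _ (fun i _ => mulrDr _ _ _)) big_split /=.
rewrite big_ord_recl bin0 [X in _ = X + _]big_ord_recl bin0 -addrA; congr (_ + _).
have -> : \sum_(i < n) 'C(n, bump 0 i)%:R * u (bump 0 i) =
    \sum_(i < n.+1) 'C(n, i.+1)%:R * u i.+1.
  by rewrite [RHS]big_ord_recr /= bin_small// mul0r addr0.
by rewrite -big_split; apply: eq_bigr => i _; rewrite /bump /= binS natrD; ring.
Qed.

Lemma newton_forward f h x m :
  f (x + m%:R * h) = \sum_(k < m.+1) 'C(m, k)%:R * iter k (fdiff h) f x.
Proof.
elim: m f x => [|m IH] f x; first by rewrite mul0r addr0 big_ord1 mul1r.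
rewrite (pascal_sum (fun k => iter k (fdiff h) f x)).
rewrite (eq_bigr _ (fun i _ => mulrDr _ _ _)) big_split /= -IH.
under [X in _ = _ + X]eq_bigr do rewrite -[fdiff h _ x]/(iter _.+1 (fdiff h) f x) iterSr.
by rewrite -IH /fdiff -natr1 mulrDl mul1r addrA; ring.
Qed.

Lemma newton_forward_wide f h x m N : (m < N)%N ->
  f (x + m%:R * h) = \sum_(0 <= k < N) 'C(m, k)%:R * iter k (fdiff h) f x.
Proof.
move=> mN; rewrite newton_forward.
rewrite -(big_mkord xpredT (fun k => 'C(m, k)%:R * iter k (fdiff h) f x)).
rewrite [RHS](big_cat_nat (n := m.+1) _ mN)//= [X in _ = _ + X]big_nat.
rewrite [X in _ = _ + X]big1 ?addr0// => k /andP[mk _].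
by rewrite bin_small// mul0r.
Qed.

(** Doubling the step: E^2 - 1 = (1 + E) (E - 1) for the shift E by h, raised to
    the power k. *)
Lemma iter_fdiff_double k h f x : iter k (fdiff (h + h)) f x =
  \sum_(j < k.+1) 'C(k, j)%:R * iter k (fdiff h) f (x + j%:R * h).
Proof.
elim: k f x => [|k IH] f x; first by rewrite big_ord1 mul1r /= mul0r addr0.
rewrite (pascal_sum (fun j => iter k.+1 (fdiff h) f (x + j%:R * h))) iterSr.
have -> : fdiff (h + h) f = (fun y => fdiff h f y + fdiff h f (y + h)).
  by apply/funext => y; rewrite /fdiff addrA; ring.
rewrite IH; apply: eq_bigr => j _; rewrite iter_fdiffD iter_fdiff_shift !iterSr.
by rewrite -natr1 mulrDl mul1r addrA.
Qed.

End FiniteDifferences.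

(** * Bernstein's theorem for absolutely monotone functions *)

Section Bernstein.
Context {R : realType}.
Implicit Types (f : R -> R) (a : R^nat) (b h x y : R).

Lemma power_series_lipschitz alpha a f c : power_series_on alpha a f ->
  sym_itv alpha c -> exists C : R, exists2 r : R, 0 < r &
    forall h, `|h| <= r -> `|f (c + h) - f c| <= C * `|h|.
Proof.
move=> af ca; have [A _ HA] := pseries_recenter af ca.
have [r cr ra] := sym_itv_room ca.
pose s := (r - `|c|) / 2; have s0 : 0 < s by rewrite divr_gt0// subr_gt0.
have As : power_series_on (r - `|c|)%:E A (fun h => f (c + h)).
  move=> h /sym_itv_fin hr; apply: HA; apply: sym_itv_le ra.
  by rewrite ger0_norm ?addr_ge0// (le_trans _ (ler_norm r))//; lra.
have sI : sym_itv (r - `|c|)%:E s by apply/sym_itv_fin; rewrite gtr0_norm// /s; lra.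
have := is_cvg_pseries_norm As sI; rewrite gtr0_norm// => cvA.
have [C _ HC] := pseries_remainder 1 s0 cvA.
exists C, s => // h hs; have := HC h (f (c + h)) hs.
rewrite big_ord1 expr0 mulr1 expr1 -(power_series_at0 _ As) ?lte_fin ?subr_gt0// addr0.
apply; apply: As; apply/sym_itv_fin; move: hs; rewrite /s; lra.
Qed.

Lemma ffact_scale_cvg (mu : nat -> nat) (s : R^nat) x k :
  (forall m, 0 <= s m) -> s @ \oo --> (0 : R) -> (forall m, (mu m)%:R * s m = x) ->
  (fun m => ((mu m) ^_ k)%:R * s m ^+ k) @ \oo --> x ^+ k.
Proof.
move=> s0 sc smu; elim: k => [|k IH].
  by under eq_fun do rewrite ffactn0 mul1r expr0; exact: cvg_cst.
have c1 : (fun m => (mu m - k)%:R * s m) @ \oo --> x.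
  have lo : (fun m => x - k%:R * s m) @ \oo --> x.
    rewrite -[X in _ --> X]subr0 -[X in _ --> _ - X](mulr0 k%:R).
    by apply: cvgB; [exact: cvg_cst|exact: cvgMl_tmp].
  apply: (squeeze_cvgr _ lo (cvg_cst x)); near=> m.
  rewrite -(smu m) -mulrBl; apply/andP; split; rewrite ler_wpM2r//.
    by rewrite lerBlDr -natrD ler_nat; lia.
  by rewrite ler_nat leq_subr.
rewrite [X in _ --> X]exprSr.
have -> : (fun m => ((mu m) ^_ k.+1)%:R * s m ^+ k.+1) =
    (fun m => ((mu m) ^_ k)%:R * s m ^+ k * ((mu m - k)%:R * s m)).
  by apply/funext => m; rewrite ffactnSr natrM exprSr; ring.
exact: cvgM.
Unshelve. all: by end_near. Qed.

(** Each factor (mu - i) / (M - i) of the quotient of binomials is at most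
    mu / M. *)
Lemma binom_ratio mu M k : (mu <= M)%N ->
  ('C(mu, k) * M ^ k <= 'C(M, k) * mu ^ k)%N.
Proof.
move=> muM; rewrite -(@leq_pmul2r k`!) ?fact_gt0//.
rewrite mulnAC bin_ffact [leqRHS]mulnAC bin_ffact.
elim: k => // k IH; rewrite !ffactnSr !expnSr mulnACA [leqRHS]mulnACA leq_mul//.
by rewrite !mulnBl [(M * mu)%N]mulnC leq_sub2l// leq_mul2l muM orbT.
Qed.

Section FixedInterval.
Variables (b : R) (f : R -> R).
Hypothesis b0 : 0 < b.
Hypothesis f_am : forall k h x, 0 <= h -> 0 <= x -> x + k%:R * h <= b ->
  0 <= iter k (fdiff h) f x.

Let step m : R := b / 2 ^+ m.

Let step_gt0 m : 0 < step m.
Proof. by rewrite divr_gt0 ?exprn_gt0. Qed.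

Let stepS m : step m = step m.+1 + step m.+1.
Proof. by rewrite /step exprS; field; rewrite expf_neq0. Qed.

Let step_mul m : (2 ^ m)%:R * step m = b.
Proof. by rewrite natrX mulrC /step divfK// expf_neq0. Qed.

Let step_cvg0 : step @ \oo --> (0 : R).
Proof.
have : (fun m => b * (2^-1) ^+ m) @ \oo --> b * 0.
  apply: cvgMl_tmp; apply: cvg_expr.
  by rewrite gtr0_norm ?invr_gt0// invf_lt1// ltr1n.
rewrite mulr0; apply: cvg_trans; apply: near_eq_cvg; near=> m.
by rewrite /step exprVn.
Unshelve. all: by end_near. Qed.

Let am_le x y : 0 <= x -> x <= y -> y <= b -> f x <= f y.
Proof.
move=> x0 xy yb; have := @f_am 1 (y - x) x; rewrite /= /fdiff mul1r addrCA subrr addr0.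
by rewrite !subr_ge0; apply.
Qed.

(** As m grows this tends to the k-th derivative of f at 0 from the right. *)
Let quot k m := iter k (fdiff (step m)) f 0 / step m ^+ k.

Let quot_ge0 k m : (k <= 2 ^ m)%N -> 0 <= quot k m.
Proof.
move=> km; rewrite divr_ge0 ?exprn_ge0 ?(ltW (step_gt0 _))//.
apply: f_am; rewrite ?(ltW (step_gt0 _))// add0r -(step_mul m).
by rewrite ler_wpM2r ?ler_nat// ltW.
Qed.

(** The difference with the double step is a sum of 2^k differences with the
    single step, at points j h >= 0 where they are at least as large as at 0. *)
Let quot_noninc k m : (k <= 2 ^ m)%N -> quot k m.+1 <= quot k m.
Proof.
move=> km; rewrite /quot (stepS m) iter_fdiff_double.
set h := step m.+1; have h0 : 0 < h by exact: step_gt0.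
have -> : (h + h) ^+ k = 2 ^+ k * h ^+ k by rewrite -exprMn; congr (_ ^+ _); ring.
have hk : 0 < h ^+ k by rewrite exprn_gt0.
rewrite ler_pdivlMr ?mulr_gt0 ?exprn_gt0// mulrCA divfK; last by rewrite gt_eqF.
have hb j : (j <= k)%N -> 0 + j%:R * h + k%:R * h <= b.
  move=> jk; rewrite add0r -(step_mul m) stepS -/h mulrDr.
  by rewrite lerD// ler_wpM2r ?(ltW h0)// ler_nat// (leq_trans jk).
have mono j : (j <= k)%N ->
    iter k (fdiff h) f 0 <= iter k (fdiff h) f (0 + j%:R * h).
  elim: j => [|j IH] jk; first by rewrite mul0r addr0.
  apply: (le_trans (IH (ltnW jk))).
  have := @f_am k.+1 h (0 + j%:R * h) (ltW h0); rewrite iterS /fdiff subr_ge0.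
  rewrite -(natr1 j) mulrDl mul1r addrA; apply.
    by rewrite add0r mulr_ge0 ?(ltW h0).
  by have := hb _ jk; rewrite -(natr1 j) -(natr1 k) !mulrDl; lra.
have -> : 2 ^+ k = \sum_(j < k.+1) 'C(k, j)%:R :> R.
  by rewrite -[2]/(1 + 1) exprDn; apply: eq_bigr => j _; rewrite !expr1n mulr1.
rewrite mulr_suml; apply: ler_sum => j _.
by rewrite ler_wpM2l// mono// -ltnS.
Qed.

Let leq_exp2 k m : (k <= 2 ^ (m + k))%N.
Proof.
apply: (leq_trans (ltnW (ltn_expl k (isT : (1 < 2)%N)))).
by rewrite leq_exp2l// leq_addl.
Qed.

Let coef k := limn (fun m => quot k (m + k)%N) / k`!%:R.

Let quot_cvg k : quot k @ \oo --> k`!%:R * coef k.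
Proof.
rewrite /coef mulrC divfK ?pnatr_eq0 -?lt0n ?fact_gt0//.
rewrite -(cvg_shiftn k); apply: nonincreasing_is_cvgn.
  by apply/nonincreasing_seqP => m; rewrite /= addSn; exact: quot_noninc.
by exists 0 => _ [m _ <-]; exact: quot_ge0.
Qed.

Let coef_ge0 k : 0 <= coef k.
Proof.
rewrite -(@pmulr_rge0 _ k`!%:R) ?ltr0n ?fact_gt0//.
apply: (ler_cvg_to (cvg_cst 0) (@quot_cvg k)); near=> m.
apply: quot_ge0; apply: (@leq_trans (2 ^ (m - k + k)))%N => //.
by rewrite subnK//; near: m; exact: nbhs_infty_ge.
Unshelve. all: by end_near. Qed.

(** Write x for the dyadic point.  Newton's formula for f x and for f b, on a
    fine grid, has nonnegative terms, and the term of index k for x is at most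
    (x / b)^k times the one for b.  So the terms from K on add up to at most
    (x / b)^K f b, uniformly in the mesh; then let the mesh go to 0. *)
Let dyadic_remainder p q K : (p < 2 ^ q)%N ->
  `|f (p%:R * step q) - pseries coef (p%:R * step q) K|
    <= (p%:R * step q / b) ^+ K * f b.
Proof.
move=> pq; set x := p%:R * step q; set rho := x / b.
pose s m := step (m + q); pose mu m := (p * 2 ^ m)%N; pose M m := (2 ^ (m + q))%N.
have s0 m : 0 < s m by exact: step_gt0.
have sM m : (M m)%:R * s m = b by exact: step_mul.
have s_mu m : (mu m)%:R * s m = x.
  rewrite /mu /s /x /step exprD natrM natrX; field.
  by rewrite !expf_neq0.
have rhoE m : rho = (mu m)%:R / (M m)%:R.
  by rewrite /rho -(s_mu m) -(sM m) invfM mulrACA divff ?mulr1// gt_eqF.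
have rho0 : 0 <= rho by rewrite (rhoE 0%N) divr_ge0.
have rho1 : rho <= 1.
  rewrite (rhoE 0%N) ler_pdivrMr ?ltr0n ?expn_gt0// mul1r ler_nat /mu /M.
  by rewrite muln1 ltnW.
pose t k m := 'C(mu m, k)%:R * iter k (fdiff (s m)) f 0.
have tail m : `|f x - \sum_(k < K) t k m| <= rho ^+ K * f b.
  pose N := (M m + K).+1.
  have KN : (K <= N)%N by rewrite /N; lia.
  have muM : (mu m <= M m)%N.
    by rewrite /mu /M addnC expnD leq_mul2r ltnW ?orbT.
  have muN : (mu m < N)%N by rewrite ltnS (leq_trans muM)// leq_addr.
  have MN : (M m < N)%N by rewrite ltnS leq_addr.
  have D0 k : 0 <= 'C(M m, k)%:R * iter k (fdiff (s m)) f 0.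
    have [kM|Mk] := leqP k (M m); last by rewrite bin_small// mul0r.
    rewrite mulr_ge0// f_am ?(ltW (s0 m))// add0r -(sM m).
    by rewrite ler_wpM2r ?(ltW (s0 m))// ler_nat.
  (* for k > M both binomials vanish, so nothing is claimed about differences
     that leave the segment *)
  have tle k : 0 <= t k m <= rho ^+ k * ('C(M m, k)%:R * iter k (fdiff (s m)) f 0).
    rewrite /t; have [kM|Mk] := leqP k (M m); last first.
      by rewrite !bin_small ?(leq_ltn_trans muM)// !mul0r mulr0 lexx.
    have D0' : 0 <= iter k (fdiff (s m)) f 0.
      by have := D0 k; rewrite pmulr_rge0// ltr0n bin_gt0.
    rewrite mulr_ge0//= mulrA ler_wpM2r// (rhoE m) expr_div_n mulrAC.
    rewrite ler_pdivlMr ?exprn_gt0 ?ltr0n ?expn_gt0//.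
    by rewrite -!natrX -!natrM ler_nat [leqRHS]mulnC binom_ratio.
  have fx : f x = \sum_(0 <= k < N) t k m.
    by rewrite -(s_mu m) -[X in f X]add0r (newton_forward_wide _ _ _ muN).
  have fb : f b = \sum_(0 <= k < N) 'C(M m, k)%:R * iter k (fdiff (s m)) f 0.
    by rewrite -[in LHS](sM m) -[X in f X]add0r (newton_forward_wide _ _ _ MN).
  rewrite fx (big_cat_nat (n := K) _ KN)//= big_mkord addrAC subrr add0r.
  rewrite ger0_norm; last by apply: sumr_ge0 => k _; have /andP[] := tle k.
  rewrite fb mulr_sumr [leRHS](big_cat_nat (n := K) _ KN)//=.
  apply: ler_wpDl; first by apply: sumr_ge0 => k _; rewrite mulr_ge0 ?exprn_ge0.
  apply: ler_sum_nat => k /andP[Kk _]; have /andP[_] := tle k.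
  by move/le_trans; apply; rewrite ler_wpM2r// ler_wiXn2l.
have s_cvg0 : s @ \oo --> (0 : R).
  by have := step_cvg0; rewrite -(cvg_shiftn q).
have t_cvg k : t k @ \oo --> coef k * x ^+ k.
  have c1 := @ffact_scale_cvg mu s x k (fun m => ltW (s0 m)) s_cvg0 s_mu.
  have c2 : (fun m => quot k (m + q)%N) @ \oo --> k`!%:R * coef k.
    by have := @quot_cvg k; rewrite -(cvg_shiftn q).
  have k0 : k`!%:R != 0 :> R by rewrite pnatr_eq0 -lt0n fact_gt0.
  have : (fun m => ((mu m) ^_ k)%:R * s m ^+ k * (quot k (m + q)%N) / k`!%:R) @ \oo -->
      x ^+ k * (k`!%:R * coef k) / k`!%:R by apply: cvgMr_tmp; exact: cvgM.
  have -> : x ^+ k * (k`!%:R * coef k) / k`!%:R = coef k * x ^+ k by field.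
  apply: cvg_trans; apply: near_eq_cvg; near=> m.
  rewrite /t /quot -/(s m) -bin_ffact natrM; field.
  by rewrite k0 expf_neq0 ?gt_eqF.
have cv : (fun m => `|f x - \sum_(k < K) t k m|) @ \oo --> `|f x - pseries coef x K|.
  apply: cvg_norm; apply: cvgB; first exact: cvg_cst.
  by rewrite pseriesEord; apply: (@cvg_sum_ord _ K t (fun k => coef k * x ^+ k)).
by apply: (ler_cvg_to cv (cvg_cst _)); near=> m; exact: tail.
Unshelve. all: by end_near. Qed.

Let dyadic_sum p q : (p < 2 ^ q)%N ->
  pseries coef (p%:R * step q) @ \oo --> f (p%:R * step q).
Proof.
move=> pq; set x := p%:R * step q.
have x0 : 0 <= x / b by rewrite !mulr_ge0 ?invr_ge0 ?(ltW (step_gt0 _)) ?(ltW b0).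
have x1 : `|x / b| < 1.
  rewrite ger0_norm// ltr_pdivrMr// mul1r -(step_mul q) /x.
  by rewrite ltr_pM2r// ltr_nat.
have cvq : (fun K => (x / b) ^+ K * f b) @ \oo --> (0 : R).
  by rewrite -[X in _ --> X](mul0r (f b)); apply: cvgMr_tmp; exact: cvg_expr.
apply/subr_cvg0/norm_cvg0P; apply: squeeze_cvgr (cvg_cst 0) cvq.
by near=> K; rewrite normr_ge0 distrC; exact: dyadic_remainder.
Unshelve. all: by end_near. Qed.

Let dyadic_floor x m : 0 <= x -> let p := Num.truncn (x / step m) in
  p%:R * step m <= x < p.+1%:R * step m.
Proof.
move=> x0 /=; rewrite -ler_pdivlMr ?step_gt0// -ltr_pdivrMr ?step_gt0//.
by apply: truncn_itv; rewrite divr_ge0// ltW.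
Qed.

(** The series has the right sum at dyadic points.  Elsewhere f, being monotone,
    is squeezed between its values at two neighbouring dyadic points, and the
    sum of the series is continuous. *)
Lemma absolutely_monotone_on_segment : exists2 a : R^nat, (forall k, 0 <= a k) &
  exists2 F, power_series_on b%:E a F & forall x, 0 <= x < b -> f x = F x.
Proof.
exists coef => //; pose F x := limn (pseries coef x).
have below x : `|x| < b -> \forall m \near \oo, `|x| + step m < b.
  move=> xb; apply: (cvgr_lt `|x|) => //; rewrite -[X in _ --> X]addr0.
  by apply: cvgD; [exact: cvg_cst|exact: step_cvg0].
have grid m p : p%:R * step m < b -> (p < 2 ^ m)%N.
  by rewrite -(step_mul m) ltr_pM2r// ltr_nat.
have pF : power_series_on b%:E coef F.
  move=> x /sym_itv_fin xb; have [m _ /(_ m (leqnn m)) xm] := below _ xb.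
  have /andP[px xp] := dyadic_floor m (normr_ge0 x).
  set p := Num.truncn _ in px xp.
  apply: is_cvg_pseries_inside (_ : cvgn (pseries coef (p.+1%:R * step m))) _.
    apply/cvg_ex; eexists; apply: dyadic_sum; apply: grid.
    by rewrite -natr1 mulrDl mul1r; lra.
  by rewrite (lt_le_trans xp) ?ler_norm.
exists F => // x /andP[x0 xb].
have xI : sym_itv b%:E x by apply/sym_itv_fin; rewrite ger0_norm.
have [C [r r0 HC]] := power_series_lipschitz pF xI.
apply/eqP; rewrite -subr_eq0 -normr_le0.
have cvC : (fun m => `|C| * step m) @ \oo --> (0 : R).
  by rewrite -[X in _ --> X](mulr0 `|C|); apply: cvgMl_tmp; exact: step_cvg0.
apply: (ler_cvg_to (cvg_cst _) cvC); near=> m.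
have mb : x + step m < b.
  by rewrite -[x]ger0_norm//; near: m; apply: below; rewrite ger0_norm.
have mr : step m <= r by near: m; apply: (cvgr_le (0 : R)) => //; exact: step_cvg0.
have /andP[px xp] := dyadic_floor m x0; set p := Num.truncn _ in px xp.
have pSE : p.+1%:R * step m = p%:R * step m + step m by rewrite -natr1 mulrDl mul1r.
rewrite pSE in xp.
have sm := step_gt0 m.
have pm0 : 0 <= p%:R * step m by rewrite mulr_ge0// ltW.
have FE n : (n < 2 ^ m)%N -> F (n%:R * step m) = f (n%:R * step m).
  by move=> nm; exact/cvg_lim/dyadic_sum.
have lo := @am_le _ _ pm0 px (ltW xb).
have hi := @am_le x (p%:R * step m + step m) x0 (ltW xp) _.
rewrite -FE in lo; last by apply: grid; lra.
rewrite -pSE -FE in hi; last by apply: grid; lra.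
have h1 := HC (p%:R * step m - x); have h2 := HC (p.+1%:R * step m - x).
rewrite !(addrCA x) !subrr !addr0 pSE in h1 h2.
have Cle (d : R) : `|d| <= step m -> C * `|d| <= `|C| * step m.
  move=> dm; apply: (le_trans (ler_wpM2r (normr_ge0 d) (ler_norm C))).
  exact: ler_wpM2l.
have d1 : `|p%:R * step m - x| <= step m by rewrite ler_norml; lra.
have d2 : `|p%:R * step m + step m - x| <= step m by rewrite ler_norml; lra.
have {}h1 := le_trans (h1 (le_trans d1 mr)) (Cle _ d1).
have {}h2 := le_trans (h2 (le_trans d2 mr)) (Cle _ d2).
have {}hi : f x <= F (p%:R * step m + step m) by rewrite -pSE hi// pSE; lra.
move: h1 h2; rewrite !ler_norml => /andP[h1 _] /andP[_ h2].
by apply/andP; split; lra.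
Unshelve. all: by end_near. Qed.

End FixedInterval.

(** Bernstein's theorem.  The coefficients found on the segments [0, b] do not
    depend on b, by uniqueness. *)
Lemma absolutely_monotone_power_series (alpha : \bar R) f : (0 < alpha)%E ->
  (forall k h x, 0 <= h -> 0 <= x -> sym_itv alpha (x + k%:R * h) ->
     0 <= iter k (fdiff h) f x) ->
  exists2 a : R^nat, (forall k, 0 <= a k) &
    forall x, 0 <= x -> sym_itv alpha x -> pseries a x @ \oo --> f x.
Proof.
move=> alpha0 f_am.
have am b : sym_itv alpha b -> forall k h x, 0 <= h -> 0 <= x -> x + k%:R * h <= b ->
    0 <= iter k (fdiff h) f x.
  move=> ba k h x h0 x0 xb; apply: f_am => //; apply: sym_itv_le ba.
  by rewrite ger0_norm ?addr_ge0 ?mulr_ge0// (le_trans xb)// ler_norm.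
have [|b] := @sym_itv_room _ alpha 0; first by apply/sym_itvE; rewrite normr0.
rewrite normr0 => b0 ba.
have [a a0 [F aF fF]] := absolutely_monotone_on_segment b0 (am _ ba).
exists a => // x x0 xa; have [c xc ca] := sym_itv_room xa.
rewrite ger0_norm// in xc; have c0 : 0 < c by exact: le_lt_trans xc.
have [a' a'0 [F' aF' fF']] := absolutely_monotone_on_segment c0 (am _ ca).
have m0 : 0 < Num.min b c by rewrite lt_min b0.
suff -> : a = a'.
  by rewrite fF' ?x0//; apply: aF'; apply/sym_itv_fin; rewrite ger0_norm.
apply: (@power_series_on_unique _ _ _ F F' 1 _ _ m0 m0 (normr1 _)).
- by apply: sub_power_series_on aF => y /sym_itv_fin;
    rewrite lt_min => /andP[? _]; exact/sym_itv_fin.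
- by apply: sub_power_series_on aF' => y /sym_itv_fin;
    rewrite lt_min => /andP[_ ?]; exact/sym_itv_fin.
- move=> t /andP[t0]; rewrite lt_min mul1r => /andP[tb tc].
  by rewrite -fF ?(ltW t0)// -fF' ?(ltW t0).
Qed.

End Bernstein.

(** * S-positive functions are power series *)

Section Schoenberg.
Context {R : realType}.
Implicit Types (alpha : \bar R) (f g : R -> R) (a : R^nat) (b h x y t : R).

Lemma S_positive_absolutely_monotone alpha f : S_positive alpha f ->
  forall k h x, 0 <= h -> 0 <= x -> sym_itv alpha (x + k%:R * h) ->
    0 <= iter k (fdiff h) f x.
Proof.
move=> fa k h x h0 x0 xa; have [b xb ba] := sym_itv_room xa.
have fb : S_positive b%:E f.
  apply: S_positive_sub fa => y /sym_itv_fin yb; apply: sym_itv_le ba.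
  by rewrite (le_trans (ltW yb)) ?ler_norm.
rewrite ger0_norm in xb; last by rewrite addr_ge0 ?mulr_ge0.
have xI : sym_itv (b - k%:R * h)%:E x.
  by apply/sym_itv_fin; rewrite ger0_norm//; lra.
have := S_positive_norm_le (y := x) (@S_positive_iter_fdiff _ _ _ _ k h0 fb) xI.
rewrite ger0_norm// lexx => /(_ isT); exact: le_trans.
Qed.

Lemma iter_fdiff_bound g (B M t : R) n x : 0 <= t ->
  (forall y, `|y| <= B -> `|g y| <= M) -> `|x| + n%:R * t <= B ->
  `|iter n (fdiff t) g x| <= 2 ^+ n * M.
Proof.
move=> t0 gM; elim: n x => [|n IH] x; first by rewrite mul0r addr0 mul1r; exact: gM.
rewrite -natr1 mulrDl mul1r => xB; rewrite iterS /fdiff exprS -mulrA mulr_natl mulr2n.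
apply: (le_trans (ler_normB _ _)); apply: lerD; apply: IH; last by lra.
have := ler_normD x t; rewrite (ger0_norm t0); lra.
Qed.

Lemma iter_fdiff_sum n t m (c : R^nat) (g : nat -> R -> R) x :
  iter n (fdiff t) (fun y => \sum_(j < m) c j * g j y) x =
  \sum_(j < m) c j * iter n (fdiff t) (g j) x.
Proof.
elim: n x => //= n IH x; rewrite /fdiff !IH -sumrB.
by apply: eq_bigr => j _; rewrite mulrBr.
Qed.

(** A difference lowers the degree of a polynomial. *)
Lemma iter_fdiff_exp n t k x : (k < n)%N ->
  iter n (fdiff t) (fun y => y ^+ k) x = 0.
Proof.
elim: n k x => // n IH k x kn; rewrite iterSr.
have -> : fdiff t (fun y => y ^+ k) =
    (fun y => \sum_(j < k) ('C(k, j)%:R * t ^+ (k - j)) * y ^+ j).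
  apply/funext => y; rewrite /fdiff [y + t]addrC exprDn big_ord_recr /= subnn mul1r binn addrK.
  by apply: eq_bigr => j _; rewrite -mulr_natl mulrA.
rewrite (iter_fdiff_sum n t k (fun j => 'C(k, j)%:R * t ^+ (k - j)) (fun j y => y ^+ j)).
by rewrite big1// => j _; rewrite IH ?mulr0// (leq_trans (ltn_ord j)).
Qed.

(** The Taylor polynomial of degree < n is killed by n differences, and the
    remainder is O(t^n) on the points involved, all of size at most (n + 1) t. *)
Lemma iter_fdiff_pseries alpha a (F : R -> R) n : (0 < alpha)%E ->
  power_series_on alpha a F -> exists C : R, exists2 d : R, 0 < d &
    forall t x, 0 < t < d -> `|x| <= t -> `|iter n (fdiff t) F x| <= C * t ^+ n.
Proof.
move=> alpha0 aF.
have [|b] := @sym_itv_room _ alpha 0; first by apply/sym_itvE; rewrite normr0.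
rewrite normr0 => b0 ba; have := is_cvg_pseries_norm aF ba.
rewrite gtr0_norm// => cvb; have [C C0 HC] := pseries_remainder n b0 cvb.
exists (2 ^+ n * (C * n.+1%:R ^+ n)), (b / n.+1%:R); first by rewrite divr_gt0.
move=> t x /andP[t0]; rewrite ltr_pdivlMr// => tb xt.
pose P y := \sum_(k < n) a k * y ^+ k.
have -> : F = (fun y => P y + (F y - P y)) by apply/funext => y; rewrite addrC subrK.
rewrite iter_fdiffD (iter_fdiff_sum n t n a (fun k y => y ^+ k)).
rewrite big1 ?add0r => [|k _]; last by rewrite iter_fdiff_exp ?mulr0.
rewrite -!mulrA -exprMn.
apply: (@iter_fdiff_bound _ (n.+1%:R * t)); first exact: ltW.
  move=> y yt; have yb : `|y| <= b by rewrite (le_trans yt)// mulrC ltW.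
  apply: (le_trans (HC y (F y) yb _)).
    by apply: aF; apply: sym_itv_le ba; rewrite [leRHS]gtr0_norm.
  by rewrite ler_wpM2l// lerXn2r ?nnegrE ?mulr_ge0// ltW.
by rewrite -natr1 mulrDl mul1r addrC lerD2l.
Qed.

Lemma iter_fdiff_vanish g (B t : R) n y : 0 <= t ->
  (forall z, 0 <= z <= B -> g z = 0) -> 0 <= y -> y + n%:R * t <= B ->
  iter n (fdiff t) g y = 0.
Proof.
move=> t0 g0; elim: n y => [|n IH] y y0; first by rewrite mul0r addr0 => yB; apply: g0; rewrite y0.
rewrite -natr1 mulrDl mul1r => yB; rewrite iterS /fdiff !IH ?subrr ?addr_ge0//; lra.
Qed.

(** Among the points - t, 0, t, 2 t, ... of the difference, only the first one
    contributes. *)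
Lemma iter_fdiff_jump g (B t : R) n : 0 <= t ->
  (forall z, 0 <= z <= B -> g z = 0) -> n%:R * t <= B ->
  iter n (fdiff t) g (- t) = (-1) ^+ n * g (- t).
Proof.
move=> t0 g0; elim: n => [|n IH] nB; first by rewrite mul1r.
rewrite -natr1 mulrDl mul1r in nB.
rewrite iterS {1}/fdiff IH; last by lra.
rewrite addNr (iter_fdiff_vanish t0 g0)//; last by lra.
by rewrite exprS; ring.
Qed.

(** Schoenberg's theorem.  Both one-sided series come from Bernstein's theorem
    applied to the even and odd parts of f; that they are the same series comes
    from flatness of the discrepancy at 0. *)
Lemma S_positive_power_series alpha f : (0 < alpha)%E -> S_positive alpha f ->
  exists2 a, power_series_on alpha a f & forall k, 0 <= a k.
Proof.
move=> alpha0 fa; have [fe fo] := S_positive_parity fa.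
have [e e0 He] := absolutely_monotone_power_series alpha0
  (S_positive_absolutely_monotone fe).
have [w w0 Hw] := absolutely_monotone_power_series alpha0
  (S_positive_absolutely_monotone fo).
pose a k := 2^-1 * (e k + w k); pose d k := 2^-1 * (e k - w k).
have psZ (c : R) (u : R^nat) x : pseries (fun k => c * u k) x = (fun n => c * pseries u x n).
  by apply/funext => n; rewrite !pseriesEord mulr_sumr; apply: eq_bigr => i _; rewrite mulrA.
have Ha x : 0 <= x -> sym_itv alpha x -> pseries a x @ \oo --> f x.
  move=> x0 xa; rewrite psZ pseriesD.
  have -> : f x = 2^-1 * ((f x + f (- x)) + (f x - f (- x))) by field.
  by apply: cvgMl_tmp; apply: cvgD; [exact: He|exact: Hw].
have Hd x : 0 <= x -> sym_itv alpha x -> pseries d x @ \oo --> f (- x).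
  move=> x0 xa; rewrite psZ pseriesB.
  have -> : f (- x) = 2^-1 * ((f x + f (- x)) - (f x - f (- x))) by field.
  by apply: cvgMl_tmp; apply: cvgB; [exact: He|exact: Hw].
pose F x := limn (pseries a x).
have aF : power_series_on alpha a F.
  move=> x xa; have [r xr ra] := sym_itv_room xa.
  apply: (@is_cvg_pseries_inside _ _ r); last by rewrite (lt_le_trans xr) ?ler_norm.
  by apply/cvg_ex; exists (f r); apply: Ha => //; rewrite (le_trans _ (ltW xr)).
have fF x : 0 <= x -> sym_itv alpha x -> f x = F x.
  by move=> x0 xa; exact/esym/cvg_lim/Ha.
have [|b] := @sym_itv_room _ alpha 0; first by apply/sym_itvE; rewrite normr0.
rewrite normr0 => b0 ba.
have inb x : `|x| <= b -> sym_itv alpha x.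
  by move=> xb; apply: sym_itv_le ba; rewrite [leRHS]gtr0_norm.
pose G x := limn (pseries d x).
have cF : power_series_on b%:E (fun k => d k - (-1) ^+ k * a k)
    (fun x => G x - F (-1 * x)).
  apply: power_seriesB.
    move=> x /sym_itv_fin xb.
    apply: (@is_cvg_pseries_inside _ _ b); last by rewrite (gtr0_norm b0).
    by apply/cvg_ex; exists (f (- b)); apply: Hd => //; exact: ltW.
  apply: power_series_on_scale; first by rewrite normrN1.
  by apply: sub_power_series_on aF => x /sym_itv_fin/ltW/inb.
have dE : forall k, d k - (-1) ^+ k * a k = 0.
  have b2 : 0 < b / 2 by rewrite divr_gt0.
  have b2b : sym_itv b%:E (b / 2) by apply/sym_itv_fin; rewrite gtr0_norm//; lra.
  have := is_cvg_pseries_norm cF b2b; rewrite gtr0_norm// => cv.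
  apply: (flat_pseries_eq0 b2 cv) => n.
  have [C [r r0 HC]] := iter_fdiff_pseries n alpha0 aF.
  exists (C + C), (Num.min r (b / n.+1%:R)); first by rewrite lt_min r0 divr_gt0.
  move=> t l /andP[t0]; rewrite lt_min ltr_pdivlMr// => /andP[tr tb] tl.
  have t0' := ltW t0.
  have tnb : n%:R * t + t < b by rewrite -natr1 mulrDr mulr1 mulrC in tb.
  have nt0 : 0 <= n%:R * t by rewrite mulr_ge0.
  have tb' : t < b by lra.
  have ta : sym_itv alpha t by apply: inb; rewrite ger0_norm// ltW.
  (* the sum of the difference of the two series at t is the jump at - t *)
  have -> : l = f (- t) - F (- t).
    rewrite -(cvg_lim _ tl)//; have := cF t; rewrite mulN1r.
    have -> : G t = f (- t) by exact/cvg_lim/Hd.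
    move=> cFt; apply/cvg_lim => //; apply: cFt.
    by apply/sym_itv_fin; rewrite ger0_norm.
  pose g x := f x - F x.
  have g0 z : 0 <= z <= b -> g z = 0.
    move=> /andP[z0 zb]; rewrite /g fF ?subrr//.
    by apply: inb; rewrite ger0_norm.
  have gD y : iter n (fdiff t) f y = iter n (fdiff t) F y + iter n (fdiff t) g y.
    by rewrite -iter_fdiffD; congr (iter n _ _ y); apply/funext => z; rewrite /g addrC subrK.
  have gt : iter n (fdiff t) g t = 0.
    by apply: (iter_fdiff_vanish t0' g0) => //; lra.
  have gNt : iter n (fdiff t) g (- t) = (-1) ^+ n * g (- t).
    by apply: (iter_fdiff_jump t0' g0) => //; lra.
  have fb : S_positive b%:E f.
    by apply: S_positive_sub fa => y /sym_itv_fin/ltW/inb.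
  have h1 : `|iter n (fdiff t) f (- t)| <= iter n (fdiff t) f t.
    apply: (@S_positive_norm_le _ _ (iter n (fdiff t) f) t (- t)
      (@S_positive_iter_fdiff _ _ _ _ n t0' fb)); last by rewrite normrN ger0_norm.
    by apply/sym_itv_fin; rewrite ger0_norm//; lra.
  have h2 : `|iter n (fdiff t) F t| <= C * t ^+ n.
    by apply: HC; rewrite ?t0 ?tr// ger0_norm.
  have h3 : `|iter n (fdiff t) F (- t)| <= C * t ^+ n.
    by apply: HC; rewrite ?t0 ?tr// normrN ger0_norm.
  have -> : `|f (- t) - F (- t)| = `|iter n (fdiff t) f (- t) - iter n (fdiff t) F (- t)|.
    by rewrite gD addrAC subrr add0r gNt normrM normrX normrN1 expr1n mul1r.
  apply: (le_trans (ler_normB _ _)); rewrite mulrDl lerD//.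
  by apply: (le_trans h1); rewrite gD gt addr0 (le_trans (ler_norm _)).
exists a => [x xa|k]; last by rewrite mulr_ge0 ?addr_ge0.
have [x0|x0] := leP 0 x; first exact: Ha.
have nxa : sym_itv alpha (- x) by apply: sym_itv_le xa; rewrite normrN.
have := Hd (- x); rewrite opprK oppr_ge0 => /(_ (ltW x0) nxa).
suff -> : d = (fun k => (-1) ^+ k * a k) by rewrite pseries_comp_mul mulN1r opprK.
by apply/funext => k; apply/eqP; rewrite -subr_eq0 dE.
Qed.

End Schoenberg.

(** * S-monotone and S-convex functions *)

Section MonotoneConvex.
Context {R : realType}.
Implicit Types (alpha : \bar R) (f g : R -> R) (a : R^nat) (b x y d : R).

Lemma entries_in0 alpha n : (0 < alpha)%E -> entries_in alpha (0 : 'M[R]_n).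
Proof. by move=> alpha0 i j; rewrite mxE; apply/sym_itvE; rewrite normr0. Qed.

Lemma S_monotone_sub0_positive alpha f : (0 < alpha)%E -> S_monotone alpha f ->
  S_positive alpha (fun x => f x - f 0).
Proof.
move=> alpha0 fm n n0 A Aa pA.
have := fm n n0 A 0 pA.1 (@psd0 R n).1 Aa (entries_in0 alpha0).
rewrite /loewner_le subr0 => /(_ pA (psd0 _)); congr psd.
by apply/matrixP => i j; rewrite !mxE.
Qed.

(** Twice the convexity inequality for A >= 0 at the midpoint. *)
Lemma S_convex_halving_positive alpha f : (0 < alpha)%E -> S_convex alpha f ->
  S_positive alpha (fun x => f x - 2 * f (2^-1 * x) + f 0).
Proof.
move=> alpha0 fc n n0 A Aa pA.
have := fc n n0 A 0 pA.1 (@psd0 R n).1 Aa (entries_in0 alpha0).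
rewrite /loewner_le subr0 => /(_ pA (psd0 _) 2^-1 ltac:(lra)) /(psdZ (ler0n R 2)).
congr psd; apply/matrixP => i j; rewrite !mxE mulr0 addr0; by field.
Qed.

(** For B with diagonal a and off-diagonal b, compare B at the midpoint with the
    matrix obtained by adding 2 d to every entry. *)
Lemma S_convex_second_diff alpha f (a b d : R) : S_convex alpha f -> `|b| <= a -> 0 <= d ->
  sym_itv alpha (a + 2 * d) ->
  `|f (b + 2 * d) - 2 * f (b + d) + f b| <= f (a + 2 * d) - 2 * f (a + d) + f a.
Proof.
move=> fc ba d0 ad; have a0 : 0 <= a := le_trans (normr_ge0 b) ba.
have d2 : 0 <= 2 * d by rewrite mulr_ge0.
have mx22_in x y : `|x| <= a + 2 * d -> `|y| <= a + 2 * d -> entries_in alpha (mx22 x y).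
  move=> xad yad i j; rewrite mxE.
  by case: ifP => _; apply: sym_itv_le ad; rewrite [leRHS]ger0_norm// addr_ge0.
have bd : `|b + 2 * d| <= a + 2 * d.
  by rewrite (le_trans (ler_normD _ _))// (ger0_norm d2) lerD2r.
have pA : psd (mx22 (a + 2 * d) (b + 2 * d)) by exact/psd_mx22.
have pB : psd (mx22 a b) by exact/psd_mx22.
have pAB : psd (mx22 (a + 2 * d) (b + 2 * d) - mx22 a b).
  have -> : mx22 (a + 2 * d) (b + 2 * d) - mx22 a b = mx22 (2 * d) (2 * d).
    by apply/matrixP => i j; rewrite !mxE; case: ifP => _; ring.
  by apply/psd_mx22; rewrite ger0_norm.
have inA : entries_in alpha (mx22 (a + 2 * d) (b + 2 * d)).
  by apply: mx22_in => //; rewrite ger0_norm ?addr_ge0.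
have inB : entries_in alpha (mx22 a b).
  by apply: mx22_in; [rewrite ger0_norm|apply: (le_trans ba)] => //; lra.
have := fc 2%N isT _ _ pA.1 pB.1 inA inB pAB pB 2^-1 ltac:(lra).
move/(psdZ (ler0n R 2)) => H; apply/psd_mx22; move: H; congr psd.
apply/matrixP => i j; rewrite !mxE.
case: ifP => _.
  have -> : 2^-1 * (a + 2 * d) + (1 - 2^-1) * a = a + d by field.
  by field.
have -> : 2^-1 * (b + 2 * d) + (1 - 2^-1) * b = b + d by field.
by field.
Qed.

Lemma S_convex_slope alpha f x l : (0 < alpha)%E -> S_convex alpha f -> 0 <= x ->
  sym_itv alpha x -> 0 <= l <= 1 -> f (l * x) - f 0 <= l * (f x - f 0).
Proof.
move=> alpha0 fc x0 xa l01.
have pA : psd (const_mx x : 'M[R]_1).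
  have -> : const_mx x = x *: const_mx 1 :> 'M[R]_1.
    by apply/matrixP => i j; rewrite !mxE mulr1.
  by apply: psdZ => //; exact: psd_const1.
have inA : entries_in alpha (const_mx x : 'M[R]_1) by move=> i j; rewrite mxE.
have := fc 1%N isT _ _ pA.1 (@psd0 R 1).1 inA (entries_in0 alpha0).
rewrite /loewner_le subr0 => /(_ pA (psd0 _) l l01) /(psd_diag_ge0 0).
by rewrite !mxE mulr0 addr0; lra.
Qed.

Lemma half_cvg0 C : (fun n => C * 2^-1 ^+ n) @ \oo --> (0 : R).
Proof.
rewrite -[X in _ --> X](mulr0 C); apply: cvgMl_tmp; apply: cvg_expr.
by rewrite gtr0_norm ?invr_gt0// invf_lt1// ltr1n.
Qed.

Lemma le0_half (u C : R) :
  (\forall n \near \oo, u <= C * 2^-1 ^+ n) -> u <= 0.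
Proof. by move=> uC; apply: (ler_cvg_to (cvg_cst u) (@half_cvg0 C)). Qed.

Lemma half_scale_near x b : 0 < b -> \forall n \near \oo, `|2^-1 ^+ n * x| <= b.
Proof.
move=> b0; have := @half_cvg0 `|x| => /(cvgr_le (0 : R)) /(_ b b0); apply: filterS => n.
by rewrite normrM mulrC ger0_norm// exprn_ge0// invr_ge0.
Qed.

(** Let S y = f (y + 2 d) - 2 f (y + d) + f y for fixed d > 0.  Then P (2 d) = S 0
    and P (4 d) = S 0 + 2 S d + S (2 d) >= 4 S 0 = 4 P (2 d), while P x is
    c_1 x + O(x^2); hence 8 c_1 d <= 4 c_1 d + O(d^2). *)
Lemma S_convex_halving_coef1 alpha f (c : R^nat) : (0 < alpha)%E -> S_convex alpha f ->
  power_series_on alpha c (fun x => f x - 2 * f (2^-1 * x) + f 0) ->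
  (forall k, 0 <= c k) -> c 1%N = 0.
Proof.
move=> alpha0 fc cP c0; pose P x := f x - 2 * f (2^-1 * x) + f 0.
have [|b] := @sym_itv_room _ alpha 0; first by apply/sym_itvE; rewrite normr0.
rewrite normr0 => b0 ba.
have inb x : `|x| <= b -> sym_itv alpha x.
  by move=> xb; apply: sym_itv_le ba; rewrite [leRHS]gtr0_norm.
have c00 : c 0%N = 0.
  by rewrite -(power_series_at0 alpha0 cP) mulr0; ring.
apply: le_anti; rewrite c0 andbT.
have cvb := is_cvg_pseries_norm cP ba; rewrite gtr0_norm// in cvb.
have [C C0 HC] := pseries_remainder 2 b0 cvb.
have PC x : `|x| <= b -> `|P x - c 1%N * x| <= C * x ^+ 2.
  move=> xb; have := HC x (P x) xb (cP _ (inb _ xb)).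
  by rewrite 2!big_ord_recl big_ord0 c00 mul0r add0r addr0 expr1 real_normK ?num_real.
suff : c 1%N * 4 <= 0 by lra.
apply: (@le0_half _ (32 * C * (b / 4))); near=> n.
pose d := b / 4 * 2^-1 ^+ n.
have e0 : 0 < 2^-1 ^+ n :> R by rewrite exprn_gt0// invr_gt0.
have e1 : 2^-1 ^+ n <= 1 :> R by rewrite exprn_ile1// ?invr_ge0// invf_le1// ler1n.
have d0 : 0 < d by rewrite mulr_gt0// divr_gt0.
have d0' := ltW d0.
have db : 4 * d <= b.
  by rewrite /d mulrA mulrCA divff// mulr1 ler_piMr// ltW.
suff : c 1%N * 4 * d <= 32 * C * d ^+ 2.
  by rewrite expr2 mulrA ler_pM2r// /d mulrA.
have S1 := @S_convex_second_diff alpha f d 0 d fc.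
have S2 := @S_convex_second_diff alpha f (2 * d) 0 d fc.
rewrite normr0 add0r add0r in S1 S2.
have {}S1 := S1 d0' d0' ltac:(by apply: inb; rewrite ger0_norm; lra).
have {}S2 := S2 ltac:(lra) d0' ltac:(by apply: inb; rewrite ger0_norm; lra).
have E1 : d + 2 * d = 3 * d by ring. rewrite E1 in S1.
have E2 : d + d = 2 * d by ring. rewrite E2 in S1.
have E3 : 2 * d + 2 * d = 4 * d by ring. rewrite E3 in S2.
have E4 : 2 * d + d = 3 * d by ring. rewrite E4 in S2.
have P2 := PC (2 * d) ltac:(rewrite ger0_norm; lra).
have P4 := PC (4 * d) ltac:(rewrite ger0_norm; lra).
have {}S1 := le_trans (ler_norm _) S1; have {}S2 := le_trans (ler_norm _) S2.
move: P2 P4; rewrite /P.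
have -> : 2^-1 * (2 * d) = d by field.
have -> : 2^-1 * (4 * d) = 2 * d by field.
rewrite !ler_norml => /andP[P2 _] /andP[_ P4].
have E5 : (2 * d) ^+ 2 = 4 * d ^+ 2 by ring. rewrite E5 in P2.
have E6 : (4 * d) ^+ 2 = 16 * d ^+ 2 by ring. rewrite E6 in P4.
lra.
Unshelve. all: by end_near. Qed.

(** With P the function of [S_convex_halving_positive] and Q a power series such
    that Q x - 2 Q (x / 2) = P x, the function r = f - f 0 - Q satisfies
    r x = 2 r (x / 2).  Since Q is O(x^2), properties of f at a small scale pass
    to r at all scales: slopes from 0 are monotone, so r is linear on the right,
    and the bound on second differences across 0 extends this to the left. *)
Lemma S_convex_power_series alpha f : (0 < alpha)%E -> S_convex alpha f ->
  exists2 a, power_series_on alpha a f & forall k, (2 <= k)%N -> 0 <= a k.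
Proof.
move=> alpha0 fc; pose P x := f x - 2 * f (2^-1 * x) + f 0.
have [c cP c0] := S_positive_power_series alpha0 (S_convex_halving_positive alpha0 fc).
have [|b] := @sym_itv_room _ alpha 0; first by apply/sym_itvE; rewrite normr0.
rewrite normr0 => b0 ba.
have inb x : `|x| <= b -> sym_itv alpha x.
  by move=> xb; apply: sym_itv_le ba; rewrite [leRHS]gtr0_norm.
have c00 : c 0%N = 0.
  by rewrite -(power_series_at0 alpha0 cP) mulr0; ring.
have c10 := S_convex_halving_coef1 alpha0 fc cP c0.
pose w k : R := 1 - 2 * 2^-1 ^+ k; pose q k := c k / w k.
have w2 k : (2 <= k)%N -> 2^-1 <= w k.
  move=> k2; have : 2^-1 ^+ k <= 2^-1 ^+ 2 :> R.
    by apply: ler_wiXn2l => //; rewrite ?invr_ge0// invf_le1// ler1n.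
  by rewrite /w expr2; lra.
(* w 1 = 0 does no harm, as c_0 = c_1 = 0 *)
have cq k : q k * w k = c k.
  case: k => [|[|k]]; rewrite /q ?c00 ?c10 ?mul0r//.
  by rewrite divfK// gt_eqF// (lt_le_trans _ (w2 k.+2 isT))// invr_gt0.
have q0 k : 0 <= q k <= 2 * c k.
  case: k => [|[|k]]; rewrite /q ?c00 ?c10 ?mul0r ?mulr0 ?lexx//.
  have w0 : 0 < w k.+2 by rewrite (lt_le_trans _ (w2 k.+2 isT))// invr_gt0.
  rewrite divr_ge0 ?(ltW w0)//= ler_pdivrMr// mulrAC ler_peMl//.
  by have := w2 k.+2 isT; lra.
pose Q x := limn (pseries q x).
have qQ : power_series_on alpha q Q.
  move=> x xa; apply: normed_cvg.
  apply: (@series_le_cvg _ _ (fun k => 2 *: (`|c k| * `|x| ^+ k))).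
  - by move=> n; exact: normr_ge0.
  - by move=> n; rewrite mulr_ge0// mulr_ge0// exprn_ge0.
  - move=> n; rewrite /= normrM normrX [leRHS]mulrA ler_wpM2r ?exprn_ge0//.
    by have /andP[qn0 qn] := q0 n; rewrite !ger0_norm.
  - exact/is_cvg_seriesZ/(is_cvg_pseries_norm cP xa).
have [C C0 QC] : exists2 C, 0 <= C & forall x, `|x| <= b -> `|Q x| <= C * x ^+ 2.
  have cvb := is_cvg_pseries_norm qQ ba; rewrite gtr0_norm// in cvb.
  have [C C0 HC] := pseries_remainder 2 b0 cvb; exists C => // x xb.
  have := HC x (Q x) xb (qQ _ (inb _ xb)).
  by rewrite 2!big_ord_recl big_ord0 /q c00 /= c10 !mul0r !addr0 subr0 real_normK ?num_real.
pose r x := f x - f 0 - Q x.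
have half_in n x : sym_itv alpha x -> sym_itv alpha (2^-1 ^+ n * x).
  apply: sym_itv_le; rewrite normrM ler_piMl// ger0_norm ?exprn_ge0 ?invr_ge0//.
  by rewrite exprn_ile1// ?invr_ge0// invf_le1// ler1n.
(* r inherits the exact scaling law from Q x - 2 Q (x / 2) = P x *)
have r_half x : sym_itv alpha x -> r x = 2 * r (2^-1 * x).
  move=> xa; have ha := half_in 1%N _ xa; rewrite expr1 in ha.
  suff : P x = Q x - 2 * Q (2^-1 * x) by rewrite /r /P; lra.
  have <- : limn (pseries c x) = P x by exact: (power_series_on_lim cP xa).
  apply: cvg_lim => //.
  have -> : pseries c x = (fun n => pseries q x n - 2 * pseries q (2^-1 * x) n).
    apply/funext => n; rewrite !pseriesEord mulr_sumr -sumrB; apply: eq_bigr => k _.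
    by rewrite -cq /w exprMn; ring.
  by apply: cvgB; [exact: qQ|apply: cvgMl_tmp; exact: qQ].
have r_pow n x : sym_itv alpha x -> r (2^-1 ^+ n * x) = 2^-1 ^+ n * r x.
  move=> xa; elim: n => [|n IH]; first by rewrite !mul1r.
  have := r_half _ (half_in n _ xa); rewrite mulrA -exprS IH => E.
  apply: (@mulfI R 2); rewrite ?pnatr_eq0// -E.
  by rewrite exprS; field.
have e0 n : 0 < 2^-1 ^+ n :> R by rewrite exprn_gt0// invr_gt0.
(* slopes of f from 0 are monotone; at the scale e = 2^-n they are those of
   r up to O(e) *)
have slope_le x y : 0 < y -> y <= x -> sym_itv alpha x -> r y * x <= r x * y.
  move=> y0 yx xa; have x0 : 0 < x by exact: lt_le_trans yx.
  have ya : sym_itv alpha y by apply: sym_itv_le xa; rewrite !gtr0_norm.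
  rewrite -subr_le0; apply: (@le0_half _ (C * (y * x ^+ 2 + x * y ^+ 2))); near=> n.
  have exb : `|2^-1 ^+ n * x| <= b by near: n; exact: half_scale_near.
  set e := 2^-1 ^+ n in exb *; have en0 : 0 < e by exact: e0.
  have eyb : `|e * y| <= b.
    by apply: le_trans exb; rewrite !normrM !(gtr0_norm en0, gtr0_norm x0, gtr0_norm y0) ler_pM2l.
  have l01 : 0 <= y / x <= 1 by rewrite divr_ge0 ?(ltW y0) ?(ltW x0)//= ler_pdivrMr// mul1r.
  have := S_convex_slope alpha0 fc (ltW (mulr_gt0 en0 x0)) (half_in n _ xa) l01.
  have -> : y / x * (e * x) = e * y by field; rewrite gt_eqF.
  have := r_pow n _ xa; have := r_pow n _ ya; rewrite -/e /r => ry rx.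
  move=> sl; have {}sl : x * (f (e * y) - f 0) <= y * (f (e * x) - f 0).
    by have := ler_wpM2l (ltW x0) sl; rewrite mulrA [x * (y / x)]mulrC divfK ?gt_eqF.
  rewrite -(ler_pM2l en0).
  move: (QC _ exb) (QC _ eyb); rewrite !ler_norml => /andP[_ Qx] /andP[Qy _].
  have h1 := ler_wpM2l (ltW y0) Qx; have h2 := ler_wpM2l (ltW x0) Qy.
  rewrite !exprMn in h1 h2.
  have -> : e * ((f y - f 0 - Q y) * x - (f x - f 0 - Q x) * y) =
    e * (f y - f 0 - Q y) * x - e * (f x - f 0 - Q x) * y by ring.
  rewrite -ry -rx.
  have -> : e * (C * (y * x ^+ 2 + x * y ^+ 2) * e) =
    y * (C * (e ^+ 2 * x ^+ 2)) + x * (C * (e ^+ 2 * y ^+ 2)) by ring.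
  rewrite mulrN in h2; lra.
(* by the scaling law, y may be replaced by a small e y, so the order of x
   and y is irrelevant *)
have slope_le' x y : 0 < x -> 0 < y -> sym_itv alpha x -> sym_itv alpha y ->
    r y * x <= r x * y.
  move=> x0 y0 xa ya; near \oo => n.
  have eyx : `|2^-1 ^+ n * y| <= x by near: n; exact: half_scale_near.
  have en0 := e0 n; rewrite gtr0_norm ?mulr_gt0// in eyx.
  have := slope_le x _ (mulr_gt0 en0 y0) eyx xa; rewrite r_pow// -mulrA.
  by rewrite [r x * _]mulrCA ler_pM2l.
pose beta := r b / b.
have r_lin x : 0 <= x -> sym_itv alpha x -> r x = beta * x.
  rewrite le_eqVlt => /orP[/eqP <-|x0] xa.
    rewrite mulr0 /r subrr /Q (power_series_on_lim qQ)//.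
    by rewrite (power_series_at0 alpha0 qQ) /q c00 mul0r subr0.
  have : r x * b = r b * x by apply: le_anti; rewrite !slope_le'.
  by rewrite /beta mulrAC => <-; rewrite mulfK// gt_eqF.
have f_pos x : 0 <= x -> sym_itv alpha x -> f x = f 0 + beta * x + Q x.
  by move=> x0 xa; rewrite -(r_lin _ x0 xa) /r; ring.
(* at the scale t = e d, the second difference at - t is bounded by the one
   at t, which is O(t^2) since the linear part of f cancels *)
have r_neg d : 0 < d -> sym_itv alpha d -> r (- d) = - (beta * d).
  move=> d0 da; have nda : sym_itv alpha (- d) by apply: sym_itv_le da; rewrite normrN.
  apply/eqP; rewrite -addr_eq0 -normr_le0 addrC.
  apply: (@le0_half _ (20 * C * d ^+ 2)); near=> n.
  have e3db : `|2^-1 ^+ n * (3 * d)| <= b by near: n; exact: half_scale_near.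
  set e := 2^-1 ^+ n in e3db *; have en0 : 0 < e by exact: e0.
  set t := e * d; have t0 : 0 < t by rewrite mulr_gt0.
  rewrite mulrCA -/t gtr0_norm ?mulr_gt0// in e3db.
  have tb (k : R) : 0 <= k <= 3 -> `|k * t| <= b.
    move=> /andP[k0 k3]; have kt0 : 0 <= k * t by rewrite mulr_ge0// ltW.
    by rewrite ger0_norm// (le_trans _ e3db)// ler_pM2r.
  have t1 : `|t| <= b by rewrite -[t]mul1r; apply: tb; lra.
  have t2 : `|2 * t| <= b by apply: tb; lra.
  have t3 : `|3 * t| <= b by apply: tb; lra.
  have t1' : `|- t| <= b by rewrite normrN.
  have := @S_convex_second_diff alpha f t (- t) t fc.
  have -> : - t + 2 * t = t by ring.
  have -> : t + 2 * t = 3 * t by ring.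
  have -> : t + t = 2 * t by ring.
  rewrite addNr normrN (gtr0_norm t0) lexx => /(_ isT (ltW t0) (inb _ t3)).
  have p1 := f_pos t (ltW t0) (inb _ t1).
  have p2 := f_pos (2 * t) (mulr_ge0 (ler0n _ 2) (ltW t0)) (inb _ t2).
  have p3 := f_pos (3 * t) (mulr_ge0 (ler0n _ 3) (ltW t0)) (inb _ t3).
  have rt : r (- t) = e * r (- d) by rewrite -r_pow// mulrN.
  have pN : f (- t) = f 0 + e * r (- d) + Q (- t) by rewrite -rt /r; ring.
  rewrite p1 p2 p3 pN.
  move: (QC _ t1) (QC _ t2) (QC _ t3) (QC _ t1').
  have -> : (2 * t) ^+ 2 = 4 * t ^+ 2 by ring.
  have -> : (3 * t) ^+ 2 = 9 * t ^+ 2 by ring.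
  rewrite sqrrN !ler_norml => /andP[q1 q1'] /andP[q2 q2'] /andP[q3 q3'] /andP[qN qN'].
  move=> /andP[s1 s2].
  have bt : beta * t = e * (beta * d) by rewrite /t; ring.
  rewrite -ler_norml -(ler_pM2l en0) -[e in X in X <= _](gtr0_norm en0) -normrM.
  have -> : e * (20 * C * d ^+ 2 * e) = 20 * (C * t ^+ 2) by rewrite /t; ring.
  by rewrite ler_norml mulrDr -bt; apply/andP; split; lra.
pose p (k : nat) : R := if k is 0%N then f 0 else if k is 1%N then beta else 0.
have pP : power_series_on alpha p (fun x => f 0 + beta * x).
  move=> x _; have -> : f 0 + beta * x = \sum_(k < 2) p k * x ^+ k.
    by rewrite 2!big_ord_recl big_ord0 /= expr0 mulr1 addr0.
  by apply: cvg_pseries_coef_eq0 => [[|[|]]].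
exists (fun k => p k + q k) => [x xa|[|[|k]] // _]; last first.
  by rewrite add0r; have /andP[] := q0 k.+2.
have -> : f x = f 0 + beta * x + Q x.
  have [x0|x0] := leP 0 x; first exact: f_pos.
  have := r_neg (- x); rewrite oppr_gt0 x0 opprK mulrN opprK => /(_ isT) <-.
    by rewrite /r; ring.
  by apply: sym_itv_le xa; rewrite normrN.
exact: (power_seriesD pP qQ).
Unshelve. all: by end_near. Qed.

End MonotoneConvex.

Theorem theorem4p1 (R : realType) (alpha : \bar R) (f : R -> R)
    (alpha_gt0 : (0 < alpha)%E) :
  [/\ S_positive alpha f <->
        real_analytic_on (sym_itv alpha) f /\
        (forall k : nat, 0 <= derive1n k f 0),
      S_monotone alpha f <->
        real_analytic_on (sym_itv alpha) f /\
        (forall k : nat, (1 <= k)%N -> 0 <= derive1n k f 0) &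
      S_convex alpha f <->
        real_analytic_on (sym_itv alpha) f /\
        (forall k : nat, (2 <= k)%N -> 0 <= derive1n k f 0)].
Proof.
split.
- split=> [fa|[fan fd]].
    have [a af a0] := S_positive_power_series alpha_gt0 fa.
    have [|fan fd] := (@analytic_derive1n_ge0P R 0 alpha f alpha_gt0).2.
      by exists a => // k _.
    by split=> // k; exact: fd.
  have [|a af a0] := (@analytic_derive1n_ge0P R 0 alpha f alpha_gt0).1.
    by split=> // k _.
  by apply: (power_series_S_positive af) => k; exact: a0.
- rewrite analytic_derive1n_ge0P//; split=> [fm|[a af a0]]; last first.
    exact: power_series_S_monotone af a0.
  have [a af a0] := S_positive_power_series alpha_gt0
    (S_monotone_sub0_positive alpha_gt0 fm).
  have cP : power_series_on alpha (fun k => if k is 0%N then f 0 else 0) (fun=> f 0).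
    move=> x _; have := @cvg_pseries_coef_eq0 R (fun k => if k is 0%N then f 0 else 0) 1 x.
    by rewrite big_ord1 mulr1; apply; case.
  exists (fun k => a k + if k is 0%N then f 0 else 0) => [x xa|[|k] // _].
    by have := power_seriesD af cP xa; rewrite subrK.
  by rewrite addr0.
- rewrite analytic_derive1n_ge0P//; split=> [|[a af a0]].
    exact: S_convex_power_series.
  exact: power_series_S_convex af a0.
Qed.
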